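(* Let $N=n+k$ and fix $\lambda,\mu\subset(k^n)$ and $j\in\{1,\dots,N-1\}$. For each $\nu\subset(k^n)$ let $y_\nu=(y_i)_{i\in I_\nu}$ be the Bethe root described in the context, and set $[\mathcal{O}_\lambda]_\nu:=G_\lambda(y_\nu|\ominus t)$. Let $s_j$ act on formal power series in $q$ with coefficients rational in $\beta,t_1,\dots,t_N$ by interchanging $t_j$ and $t_{j+1}$. Then $$s_j\big(G_\lambda(y_{s_j\mu}|\ominus t)\big)-G_\lambda(y_\mu|\ominus t)=\begin{cases}(t_j\ominus t_{j+1})\big(\beta\,G_\lambda(y_\mu|\ominus t)+G_{s_j\lambda}(y_\mu|\ominus t)\big), & j\notin I_\lambda\text{ and } j+1\in I_\lambda,\\ 0,&\text{otherwise.}\end{cases}$$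
   Context: $\beta$ is an indeterminate, $x\oplus y=x+y+\beta xy$, $x\ominus y=(x-y)/(1+\beta y)$, $\ominus x=-x/(1+\beta x)$. A partition $\lambda\subset(k^n)$ (at most $n$ parts, each $\le k$) corresponds to the set $I_\lambda=\{\lambda_{n+1-i}+i: i=1,\dots,n\}\subset[N]$ and to the binary string $b(\lambda)\in\{0,1\}^N$ with $b_i=1$ iff $i\in I_\lambda$; $s_j\lambda$ denotes the partition whose binary string is obtained from $b(\lambda)$ by swapping its $j$-th and $(j+1)$-th letters. Factorial Grothendieck polynomial: for $x=(x_1,\dots,x_n)$ and a parameter sequence $s=(s_1,s_2,\dots)$, $G_\lambda(x|s)=\sum_T\beta^{|T|-|\lambda|}\prod_{(i,j)\in\lambda}\prod_{r\in T(i,j)}(x_r\oplus s_{r+j-i})$, summed over set-valued tableaux $T$ of shape $\lambda$ (assignments of nonempty subsets of $[n]$ to the boxes $(i,j)$ of $\lambda$, row $i$, column $j$, with $\max T(i,j)\le\min T(i,j+1)$ and $\max T(i,j)<\min T(i+1,j)$), $|T|$ the total number of entries. Here $\ominus t=(\ominus t_1,\ominus t_2,\dots)$ with $t_j=0$ for $j>N$. Bethe roots: with $\Pi(y)=\prod_i(1+\beta y_i)$, the Bethe ansatz equations for an $n$-tuple $y=(y_1,\dots,y_n)$ are $(-1)^n\frac{\Pi(y)}{(1+\beta y_i)^n}\prod_{j=1}^N (y_i\ominus t_j)+q=0$ for all $i$. For $\nu\subset(k^n)$, $y_\nu=(y_i)_{i\in I_\nu}$ denotes the solution of these equations in formal power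 series in $q$ (coefficients rational in $\beta,t$) with $y_i\equiv t_i \pmod q$ for $i\in I_\nu$ (there is exactly one such solution). Since $G_\lambda$ is symmetric in its variables the ordering of the components is immaterial. *)

(* Defs.v *)
From HB Require Import structures.
From mathcomp Require Import all_boot all_order all_algebra.
From mathcomp Require Import perm mpoly.
Set Implicit Arguments. Unset Strict Implicit. Unset Printing Implicit Defensive.
Import Order.TTheory GRing.Theory.
Local Open Scope ring_scope.

(* A partition lambda with at most n parts, each <= k, is the length-n weakly
   decreasing sequence [lambda_1; ...; lambda_n] (padded with zeros). *)
Definition in_box (n k : nat) (lam : seq nat) : bool :=
  [&& size lam == n, sorted geq lam & all (fun a => a <= k)%N lam].

(* I_lambda = { lambda_{n+1-i} + i : i = 1..n }, listed increasingly
   (0-based: lambda_{n+1-i} = nth 0%N lam (n-i)). *)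
Definition Iseq (n : nat) (lam : seq nat) : seq nat :=
  [seq (nth 0%N lam (n - i) + i)%N | i <- iota 1 n].

(* Inverse: the partition whose index set is the increasing list
   S = [i_1 < ... < i_n], namely lambda_{n+1-l} = i_l - l. *)
Definition lam_of (n : nat) (S : seq nat) : seq nat :=
  rev [seq (nth 0%N S l - l.+1)%N | l <- iota 0 n].

Definition swapn (j m : nat) : nat :=
  if m == j then j.+1 else if m == j.+1 then j else m.

(* s_j lambda : the partition whose binary string is b(lambda) with its j-th
   and (j+1)-th letters swapped, i.e. whose index set is s_j(I_lambda). *)
Definition sj_part (n j : nat) (lam : seq nat) : seq nat :=
  lam_of n (sort leq (map (swapn j) (Iseq n lam))).

Definition in_shape (lam : seq nat) (i j : nat) : bool := (j < nth 0%N lam i)%N.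

Definition svt_type (n k : nat) := {ffun 'I_n * 'I_k -> {set 'I_n}}.

(* set-valued tableaux of shape lam with entries in [n] (0-based 'I_n);
   boxes outside lam carry the empty set. *)
Definition is_svt (n k : nat) (lam : seq nat) (T : svt_type n k) : bool :=
  [forall b : 'I_n * 'I_k,
      if in_shape lam b.1 b.2 then T b != set0 else T b == set0]
  && [forall i : 'I_n, forall j1 : 'I_k, forall j2 : 'I_k,
        ((j2 : nat) == j1.+1) && in_shape lam i j1 && in_shape lam i j2 ==>
        [forall a in T (i, j1), forall c in T (i, j2), (a <= c)%N]]
  && [forall i1 : 'I_n, forall i2 : 'I_n, forall j : 'I_k,
        ((i2 : nat) == i1.+1) && in_shape lam i1 j && in_shape lam i2 j ==>
        [forall a in T (i1, j), forall c in T (i2, j), (a < c)%N]].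

Definition svt_size (n k : nat) (T : svt_type n k) : nat :=
  (\sum_(b : 'I_n * 'I_k) #|T b|)%N.

Definition oplus (R : comNzRingType) (b x y : R) : R := x + y + b * x * y.

(* G_lambda(x | s) with beta = b; s is 1-indexed (s 0 unused).
   With 0-based r, i, j the 1-based index r + j - i becomes r + j + 1 - i. *)
Definition Gfact (R : comNzRingType) (b : R) (n k : nat) (lam : seq nat)
    (x : 'I_n -> R) (s : nat -> R) : R :=
  \sum_(T : svt_type n k | is_svt lam T)
    b ^+ (svt_size T - sumn lam)%N *
    \prod_(bx : 'I_n * 'I_k | in_shape lam bx.1 bx.2)
      \prod_(r in T bx) oplus b (x r) (s (r + bx.2 + 1 - bx.1)%N).

(* variable 0 is beta, variable c (1 <= c <= N) is t_c *)
Definition Fld (N : nat) := {fraction {mpoly rat[N.+1]}}.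

Definition beta (N : nat) : Fld N := tofrac ('X_(@ord0 N)).

Definition tpar (N : nat) (c : nat) : Fld N :=
  if (1 <= c <= N)%N then tofrac ('X_(@inord N c)) else 0.

Definition frac_map (R : idomainType) (f : R -> R) (x : {fraction R})
  : {fraction R} :=
  tofrac (f (repr x).1) / tofrac (f (repr x).2).

Definition sigma (N j : nat) : Fld N -> Fld N :=
  frac_map (msym (tperm (@inord N j) (@inord N j.+1))).

Definition fominus (N : nat) (x y : Fld N) : Fld N :=
  (x - y) / (1 + beta N * y).
Definition fomin (N : nat) (x : Fld N) : Fld N := - x / (1 + beta N * x).

(* A formal power series in q over Fld N is its coefficient sequence
   nat -> Fld N; trunc m y is the polynomial sum_{i<m} y_i q^i.
   An identity of power series holds iff it holds modulo q^m for every m,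
   i.e. iff take_poly m (identity on truncations) = 0 for every m. *)
Definition trunc (F : nzRingType) (m : nat) (y : nat -> F) : {poly F} :=
  \poly_(i < m) y i.

Definition pominus (N : nat) (Y : {poly Fld N}) (c : Fld N) : {poly Fld N} :=
  (Y - c%:P) * ((1 + beta N * c)^-1)%:P.

(* Bethe ansatz equation number l, modulo q^m, after multiplying by the unit
   (1 + beta y_l)^n:
   (-1)^n Pi(y) prod_{c=1}^N (y_l (-) t_c) + q (1 + beta y_l)^n = 0. *)
Definition bae_lhs (n N m : nat) (y : 'I_n -> nat -> Fld N) (l : 'I_n)
  : {poly Fld N} :=
  (-1) ^+ n * (\prod_(l' < n) (1 + (beta N)%:P * trunc m (y l'))) *
  (\prod_(c < N) pominus (trunc m (y l)) (tpar N c.+1))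
  + 'X * (1 + (beta N)%:P * trunc m (y l)) ^+ n.

(* y is the Bethe root y_nu : its components, listed along I_nu increasingly,
   are power series with y_i = t_i mod q, solving the Bethe equations. *)
Definition is_bethe (n N : nat) (nu : seq nat) (y : 'I_n -> nat -> Fld N)
  : Prop :=
  (forall l : 'I_n, y l 0%N = tpar N (nth 0%N (Iseq n nu) l)) /\
  (forall (m : nat) (l : 'I_n), take_poly m (bae_lhs m y l) = 0).

(* G_lambda(y | (-) t) modulo q^m (as a polynomial; only coefficients < m
   are meaningful) *)
Definition Gy (n k : nat) (lam : seq nat) (m : nat)
    (y : 'I_n -> nat -> Fld (n + k)) : {poly Fld (n + k)} :=
  Gfact (beta (n + k))%:P k lam (fun l => trunc m (y l))
        (fun c => (fomin (tpar (n + k) c))%:P).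

(* Main.v *)
Require Import Defs.
From HB Require Import structures.
From mathcomp Require Import all_boot all_order all_algebra.
From mathcomp Require Import perm mpoly ring zify.
Set Implicit Arguments. Unset Strict Implicit. Unset Printing Implicit Defensive.
Import GRing.Theory.
Local Open Scope ring_scope.

(** Interchanging t_j and t_(j+1) permutes the Bethe equations and carries the
    initial values of the root attached to [s_j mu] to those of the root
    attached to [mu]; since a Bethe root is determined by its initial values
    and G is symmetric, [s_j (G(y_(s_j mu) | -t))] is G at [y_mu] with the
    parameters j and j+1 exchanged.  It remains to compute a divided difference
    in the parameters.  This is read off the bialternant formula
    [prod_(i<j) (x_i - x_j) * G_lam(x|s) = det ([x_j|s]^(lam_i+n-i) (1 + b x_j)^(i-1))]:
    the exchange affects only the row with [lam_i + n - i = j], that is,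
    [j+1 \in I_lam].  The bialternant formula is proved by induction on the number
    of letters: erasing the largest letter from a set-valued tableau gives a
    branching rule over interlacing shapes whose coefficients factor over the
    rows, and each row sum telescopes into a combination of two consecutive
    rows of the larger determinant. *)

(** * Set-valued tableaux and the branching rule *)

Section Tableaux.
Variables (R : comNzRingType) (n k : nat).
Implicit Types (T : svt_type n k) (la nu : nat -> nat).
Local Open Scope nat_scope.

(** The shape is a function on all row indices and the letters are bounded by a separate [p], which
    makes induction on the number of letters possible. The order conditions need no shape guard: an
    empty box satisfies them vacuously. *)
Definition svt la (p : nat) T : bool :=
  [&& [forall bx : 'I_n * 'I_k, (T bx != set0) == (bx.2 < la bx.1)],
      [forall i : 'I_n, forall j1 : 'I_k, forall j2 : 'I_k, (j2 == j1.+1 :> nat) ==>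
         [forall a in T (i, j1), forall c in T (i, j2), a <= c]],
      [forall i1 : 'I_n, forall i2 : 'I_n, forall j : 'I_k, (i2 == i1.+1 :> nat) ==>
         [forall a in T (i1, j), forall c in T (i2, j), a < c]]
    & [forall bx, forall a in T bx, a < p]].

Record svt_spec la (p : nat) T : Prop := SvtSpec {
  svt_shape : forall (i : 'I_n) (j : 'I_k), (T (i, j) != set0) = (j < la i);
  svt_row : forall (i : 'I_n) (j1 j2 : 'I_k) (a c : 'I_n), (j2 : nat) = j1.+1 ->
    a \in T (i, j1) -> c \in T (i, j2) -> a <= c;
  svt_col : forall (i1 i2 : 'I_n) (j : 'I_k) (a c : 'I_n), (i2 : nat) = i1.+1 ->
    a \in T (i1, j) -> c \in T (i2, j) -> a < c;
  svt_lt : forall bx (a : 'I_n), a \in T bx -> a < p }.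

Lemma svtP la p T : reflect (svt_spec la p T) (svt la p T).
Proof.
apply: (iffP and4P) => [[/forallP A /forallP B /forallP C /forallP D]|[A B C D]]; split.
- by move=> i j; have /eqP := A (i, j).
- move=> i j1 j2 a c /eqP e ha hc; move/forallP/(_ j1)/forallP/(_ j2)/implyP/(_ e): (B i).
  by move/forallP/(_ a)/implyP/(_ ha)/forallP/(_ c)/implyP/(_ hc).
- move=> i1 i2 j a c /eqP e ha hc; move/forallP/(_ i2)/forallP/(_ j)/implyP/(_ e): (C i1).
  by move/forallP/(_ a)/implyP/(_ ha)/forallP/(_ c)/implyP/(_ hc).
- by move=> bx a ha; move/forallP/(_ a)/implyP/(_ ha): (D bx).
- by apply/forallP => -[i j]; rewrite A.
- apply/'forall_'forall_'forall_implyP => i j1 j2 /eqP e.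
  by apply/'forall_implyP => a ha; apply/'forall_implyP => c hc; exact: B e ha hc.
- apply/'forall_'forall_'forall_implyP => i j1 j2 /eqP e.
  by apply/'forall_implyP => a ha; apply/'forall_implyP => c hc; exact: C e ha hc.
- by apply/forallP => bx; apply/'forall_implyP => a; apply: D.
Qed.

Lemma is_svtE (lam : seq nat) T : is_svt lam T = svt (nth 0 lam) n T.
Proof.
apply/idP/svtP.
  case/andP => /andP[/forallP A /forallP B] /forallP C.
  have A' i j : (T (i, j) != set0) = in_shape lam i j.
    by move: (A (i, j)) => /=; case: ifP => // _ /eqP->; rewrite eqxx.
  have sh i j a : a \in T (i, j) -> in_shape lam i j.
    by move=> ha; rewrite -A'; apply/set0Pn; exists a.
  split=> [i j|i j1 j2 a c e ha hc|i1 i2 j a c e ha hc|bx a _] //.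
  - move/forallP/(_ j1)/forallP/(_ j2)/implyP: (B i).
    rewrite (sh _ _ _ ha) (sh _ _ _ hc) e eqxx => /(_ isT).
    by move/forallP/(_ a)/implyP/(_ ha)/forallP/(_ c)/implyP/(_ hc).
  - move/forallP/(_ i2)/forallP/(_ j)/implyP: (C i1).
    rewrite (sh _ _ _ ha) (sh _ _ _ hc) e eqxx => /(_ isT).
    by move/forallP/(_ a)/implyP/(_ ha)/forallP/(_ c)/implyP/(_ hc).
case=> A B C _; apply/andP; split; first (apply/andP; split).
- by apply/forallP => -[i j] /=; have := A i j; rewrite /in_shape => <-; case: eqP.
- apply/'forall_'forall_'forall_implyP => i j1 j2 /andP[/andP[/eqP e _] _].
  by apply/'forall_implyP => a ha; apply/'forall_implyP => c hc; exact: B e ha hc.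
- apply/'forall_'forall_'forall_implyP => i j1 j2 /andP[/andP[/eqP e _] _].
  by apply/'forall_implyP => a ha; apply/'forall_implyP => c hc; exact: C e ha hc.
Qed.

(** Each step up a column makes the entry strictly smaller, and the box above is filled because the
    rows weakly decrease. Hence letters below [p] occur only in rows below [p]. *)
Lemma svt_row_index la p T i j (a : 'I_n) : (forall i1, la i1.+1 <= la i1) ->
  svt la p T -> a \in T (i, j) -> i <= a.
Proof.
move=> dec /svtP[A _ C _].
have [m] := ubnP (i : nat); elim: m i a => // m IHm i a ltim ha.
case Di: (i : nat) => [|i'] //.
have lti' : i' < n by rewrite -ltnS ltnW // ltnS -Di.
have : T (Ordinal lti', j) != set0.
  rewrite A /= (leq_trans _ (dec i')) // -Di -A; apply/set0Pn; by exists a.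
case/set0Pn => c hc; apply: leq_ltn_trans (C (Ordinal lti') i j c a Di hc ha).
by apply: IHm hc => /=; lia.
Qed.

Lemma card_ord_lt m : m <= k -> #|[set j : 'I_k | j < m]| = m.
Proof.
by move=> le_mk; rewrite -sum1dep_card -(big_ord_widen k (fun=> 1)) // sum1_card card_ord.
Qed.

(** A set of columns closed under predecessors is an initial segment. This justifies reading a row
    length off a cardinality in [erased_shape]. *)
Lemma mem_initial (D : {set 'I_k}) :
  (forall j1 j2 : 'I_k, (j2 : nat) = j1.+1 -> j2 \in D -> j1 \in D) ->
  forall j, (j \in D) = (j < #|D|).
Proof.
move=> step.
have down (j1 j2 : 'I_k) : j1 <= j2 -> j2 \in D -> j1 \in D.
  have [d] := ubnP (j2 - j1); elim: d j2 => // d IHd j2 ltd le12 D2.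
  case: (ltngtP j1 j2) le12 => // [lt12 _|/val_inj -> //].
  have lt2k : j2.-1 < k by apply: leq_ltn_trans (leq_pred _) (ltn_ord j2).
  apply: (IHd (Ordinal lt2k)) => /=; try lia.
  by apply: step D2 => /=; lia.
move=> j; case: (boolP (j \in D)) => [Dj|nDj]; apply/esym.
  apply/idP; rewrite -(@card_ord_lt j.+1) ?ltn_ord //; apply: subset_leq_card.
  by apply/subsetP => i; rewrite inE ltnS => /down; apply.
apply/negbTE; rewrite -leqNgt -[leqRHS](@card_ord_lt j) ?(ltnW (ltn_ord j)) //.
apply: subset_leq_card; apply/subsetP => i Di; rewrite inE ltnNge.
by apply: contra nDj => /down; apply.
Qed.

(** * Erasing and restoring the largest letter *)

Section Peel.
Variables (p : nat) (P : 'I_n).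
Hypothesis valP : (P : nat) = p.
Implicit Type mu : {ffun 'I_p -> 'I_k.+1}.

Definition erase T : svt_type n k := [ffun bx => T bx :\ P].
Definition occurrences T : {set 'I_n * 'I_k} := [set bx | P \in T bx].
Definition adjoin T (A : {set 'I_n * 'I_k}) : svt_type n k :=
  [ffun bx => if bx \in A then P |: T bx else T bx].

Lemma adjoin_erase T : adjoin (erase T) (occurrences T) = T.
Proof.
apply/ffunP => bx; rewrite !ffunE inE; case: ifP => [/setD1K //|h].
by apply/setP => a; rewrite !inE; case: eqP => // ->; rewrite h.
Qed.

(** Shapes with at most [p] rows are kept as finite functions so that one can sum over them;
    extension by zero rows turns them into arguments of [svt]. *)
Definition nat_shape (mu : {ffun 'I_p -> 'I_k.+1}) (i : nat) : nat :=
  oapp (fun i0 => mu i0 : nat) 0 (insub i).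

Lemma nat_shape_ord mu (i : 'I_p) : nat_shape mu i = mu i.
Proof. by rewrite /nat_shape valK. Qed.

Lemma nat_shape_geq mu i : p <= i -> nat_shape mu i = 0.
Proof. by move=> le_pi; rewrite /nat_shape insubF // ltnNge le_pi. Qed.

Lemma nat_shape_le mu i : nat_shape mu i <= k.
Proof. by rewrite /nat_shape; case: insub => //= i0; rewrite -ltnS. Qed.

Lemma ltpn : p < n. Proof. by rewrite -valP. Qed.

Definition widp (i : 'I_p) : 'I_n := widen_ord (ltnW ltpn) i.

Definition erased_shape T : {ffun 'I_p -> 'I_k.+1} :=
  [ffun i => inord #|[set j : 'I_k | erase T (widp i, j) != set0]|].

Definition interlaces la (mu : {ffun 'I_p -> 'I_k.+1}) : bool :=
  [forall i : 'I_p, la i.+1 <= mu i <= la i].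

(* Boxes that may contain the new largest letter p: all of la / mu must, and a
   box of mu may only if it is the end of its row and no box of la lies below. *)
Definition admissible la nu (bx : 'I_n * 'I_k) (inA : bool) : bool :=
  let: (i, j) := bx in
  if j < nu i then inA ==> (j.+1 == nu i) && (la i.+1 <= j)
  else inA == (j < la i).

Lemma erased_shapeE T mu : (forall i j, (erase T (i, j) != set0) = (j < nat_shape mu i)) ->
  erased_shape T = mu.
Proof.
move=> h; apply/ffunP => i; rewrite ffunE; apply: val_inj.
rewrite (_ : [set j | _] = [set j : 'I_k | j < nat_shape mu i]).
  by rewrite card_ord_lt ?nat_shape_le // nat_shape_ord inord_val.
by apply/setP => j; rewrite !inE h.
Qed.

Lemma interlacesP la mu : (forall i, p < i -> la i = 0) -> interlaces la mu ->
  forall i, la i.+1 <= nat_shape mu i /\ (nat_shape mu i <= la i).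
Proof.
move=> la0 /forallP h i; case: (ltnP i p) => [ltip|leip].
  by have /andP[] := h (Ordinal ltip); rewrite -(nat_shape_ord mu (Ordinal ltip)).
by rewrite nat_shape_geq // la0.
Qed.

(** One half of the bijection behind the branching rule: a tableau yields an interlacing shape, a
    tableau of that shape with one letter fewer, and an admissible set of places for the erased
    letter. *)
Lemma svt_erase la T : (forall i, la i.+1 <= la i) -> (forall i, la i <= k) ->
  (forall i, p < i -> la i = 0) -> svt la p.+1 T ->
  [/\ interlaces la (erased_shape T), svt (nat_shape (erased_shape T)) p (erase T)
    & forall bx, admissible la (nat_shape (erased_shape T)) bx (bx \in occurrences T)].
Proof.
move=> dec lek la0 svtT; have [A B C D] := svtP _ _ _ svtT.
have inT i j a : a \in T (i, j) -> j < la i.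
  by move=> ha; rewrite -A; apply/set0Pn; exists a.
have delE bx a : (a \in erase T bx) = (a < p) && (a \in T bx).
  rewrite ffunE !inE; case: (boolP (a \in T bx)); rewrite ?andbF ?andbT // => /D.
  by rewrite ltnS leq_eqVlt -valP (inj_eq val_inj); case: eqP => [->|] //; rewrite ltnn.
(* A letter smaller than [p] bounds everything to its left in the row, so boxes to the left of a
   surviving box survive as well. *)
have step i (j1 j2 : 'I_k) : (j2 : nat) = j1.+1 ->
    erase T (i, j2) != set0 -> erase T (i, j1) != set0.
  move=> e /set0Pn[c]; rewrite delE => /andP[ltcp hc].
  have : T (i, j1) != set0 by rewrite A; move/inT: hc; lia.
  case/set0Pn => a ha; apply/set0Pn; exists a; rewrite delE ha andbT.
  exact: leq_ltn_trans (B _ _ _ _ _ e ha hc) ltcp.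
have del_shape i j : (erase T (i, j) != set0) = (j < nat_shape (erased_shape T) i).
  case: (ltnP i p) => [ltip|leip].
    rewrite (nat_shape_ord _ (Ordinal ltip)) [in RHS]ffunE.
    have -> : widp (Ordinal ltip) = i by apply: val_inj.
    rewrite inordK.
      by rewrite -mem_initial ?inE // => j1 j2 e; rewrite !inE; apply: step.
    by rewrite ltnS; apply: leq_trans (max_card _) _; rewrite card_ord.
  rewrite nat_shape_geq //; apply/negbTE; rewrite negbK; apply/eqP/setP => a.
  rewrite delE inE; apply/negbTE/negP => /andP[ltap].
  by move/(svt_row_index dec svtT); rewrite leqNgt (leq_trans ltap).
have extle i : i < n -> nat_shape (erased_shape T) i <= la i.
  move=> ltin; rewrite leqNgt; apply/negP => lt.
  have ltk : la i < k by apply: leq_trans lt (nat_shape_le _ _).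
  have := del_shape (Ordinal ltin) (Ordinal ltk); rewrite /= lt => /set0Pn[a].
  by rewrite delE => /andP[_ /inT] /=; rewrite ltnn.
split.
(* If $\mu_i<\lambda_{i+1}$, the box of row [i] in column $\mu_i$ lies above a box of [la]; its
   entries are then smaller than a letter at most [p] and survive the erasure, contrary to the
   choice of $\mu_i$. *)
- apply/forallP => i; have ltin : i < n by apply: leq_trans (ltn_ord i) (ltnW ltpn).
  have := extle i ltin; rewrite nat_shape_ord => ->; rewrite andbT leqNgt; apply/negP => lt.
  have ltk : erased_shape T i < k by apply: leq_trans lt (lek _).
  have ltSn : i.+1 < n by apply: leq_ltn_trans (ltn_ord i) ltpn.
  have : T (Ordinal ltSn, Ordinal ltk) != set0 by rewrite A.
  case/set0Pn => c hc.
  have : T (Ordinal ltin, Ordinal ltk) != set0.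
    by rewrite A /=; apply: leq_trans lt (dec _).
  case/set0Pn => a ha; have ac := C (Ordinal ltin) (Ordinal ltSn) _ _ _ erefl ha hc.
  have : erase T (Ordinal ltin, Ordinal ltk) != set0.
    apply/set0Pn; exists a; rewrite delE ha andbT.
    by apply: leq_trans ac _; rewrite -ltnS; apply: D hc.
  by rewrite del_shape /= nat_shape_ord ltnn.
- apply/svtP; split => //.
  + by move=> i j1 j2 a c e; rewrite !delE => /andP[_ ha] /andP[_ hc]; apply: B e ha hc.
  + by move=> i j1 j2 a c e; rewrite !delE => /andP[_ ha] /andP[_ hc]; apply: C e ha hc.
  + by move=> bx a; rewrite delE => /andP[].
- case=> i j; rewrite /admissible inE; case: ifP => [lt|/negbT nlt].
    apply/implyP => hP; apply/andP; split.
      move: lt; rewrite leq_eqVlt => /orP[//|lt].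
      have ltk : j.+1 < k by apply: leq_trans lt (nat_shape_le _ _).
      have := del_shape i (Ordinal ltk); rewrite lt => /set0Pn[c]; rewrite delE => /andP[ltc hc].
      by have := B i j (Ordinal ltk) _ _ erefl hP hc; rewrite valP leqNgt ltc.
    rewrite leqNgt; apply/negP => ltj.
    have ltSn : i.+1 < n.
      rewrite ltnNge; apply/negP => le; move: ltj; rewrite la0 //.
      by apply: leq_trans ltpn le.
    have : T (Ordinal ltSn, j) != set0 by rewrite A.
    case/set0Pn => c hc; have := C i (Ordinal ltSn) j _ _ erefl hP hc.
    by rewrite valP ltnNge -ltnS (D _ _ hc).
  move: nlt; rewrite -del_shape negbK => /eqP del0.
  rewrite -A; apply/eqP; apply/idP/set0Pn => [hP|[a ha]]; first by exists P.
  have : a \notin erase T (i, j) by rewrite del0 inE.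
  rewrite delE ha andbT -leqNgt => le_pa.
  have -> // : P = a.
  by apply/val_inj/eqP; rewrite /= valP eqn_leq le_pa -ltnS (D _ _ ha).
Qed.

Lemma svt_notin la T bx : svt la p T -> P \notin T bx.
Proof. by case/svtP => _ _ _ D; apply/negP => /D; rewrite valP ltnn. Qed.

Lemma erase_adjoin T A : (forall bx, P \notin T bx) -> erase (adjoin T A) = T.
Proof.
move=> h; apply/ffunP => bx; rewrite !ffunE; case: ifP => _; first by rewrite setU1K.
by apply/setP => a; rewrite !inE; case: eqP => // ->; rewrite (negbTE (h _)).
Qed.

Lemma occurrences_adjoin T A : (forall bx, P \notin T bx) -> occurrences (adjoin T A) = A.
Proof.
move=> h; apply/setP => bx; rewrite !inE ffunE; case: ifP => _; rewrite ?setU11 //.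
exact/negbTE/h.
Qed.

(** The other half of the bijection. Since [p] exceeds all letters of [T], an adjoined [p] can only
    conflict with the boxes to its right and below; admissibility and interlacing leave at most [p]
    itself on the right and nothing below. *)
Lemma svt_adjoin la mu T (A : {set 'I_n * 'I_k}) : (forall i, p < i -> la i = 0) ->
  interlaces la mu -> svt (nat_shape mu) p T ->
  (forall bx, admissible la (nat_shape mu) bx (bx \in A)) ->
  svt la p.+1 (adjoin T A).
Proof.
move=> la0 intm svtT admA; have [sA sB sC sD] := svtP _ _ _ svtT.
have im := interlacesP la0 intm.
have addE bx a : (a \in adjoin T A bx) = ((a == P) && (bx \in A)) || (a \in T bx).
  by rewrite ffunE; case: ifP; rewrite ?inE ?andbT ?andbF.
have inT i j a : a \in T (i, j) -> j < nat_shape mu i.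
  by move=> ha; rewrite -sA; apply/set0Pn; exists a.
apply/svtP; split.
- move=> i j; have [h1 h2] := im i; have := admA (i, j); rewrite /admissible -sA ffunE.
  have -> : (j < la i) = (T (i, j) != set0) || ~~ (T (i, j) != set0) && (j < la i).
    by rewrite sA; case: (ltnP j (nat_shape mu i)) => //= h; rewrite (leq_trans h h2).
  case: ifP => /= [ne _|/negbT/negPn/eqP->].
    by case: ifP => // _; apply/set0Pn; exists P; rewrite setU11.
  rewrite eqxx /= => /eqP <-; case: ifP => _; last by rewrite eqxx.
  by apply/set0Pn; exists P; rewrite setU11.
- move=> i j1 j2 a c e; rewrite !addE => /orP[/andP[/eqP-> hA]|ha] /orP[/andP[/eqP-> _]|hc] //.
  + move: (admA (i, j1)); rewrite /admissible hA (_ : j1 < nat_shape mu i); last by move/inT: hc; lia.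
    by case/andP => /eqP e1 _; move/inT: hc; rewrite -e1 e ltnn.
  + by rewrite ltnW // valP; apply: sD ha.
  + exact: sB e ha hc.
- move=> i1 i2 j a c e; rewrite !addE => /orP[/andP[/eqP-> hA]|ha] hc.
    have : j < la i2.
      have [h1 h2] := im i2; case/orP: hc => [/andP[_ hA2]|/inT/leq_trans]; last exact.
      move: (admA (i2, j)); rewrite /admissible hA2; case: ifP => [lt _|_ /eqP <- //].
      exact: leq_trans lt h2.
    rewrite e => lt; have [h1 h2] := im i1.
    have lt' := leq_trans lt h1.
    move: (admA (i1, j)); rewrite /admissible lt' hA => /andP[_].
    by rewrite leqNgt lt.
  case/orP: hc => [/andP[/eqP-> _]|hc]; first by rewrite valP; apply: sD ha.
  exact: sC e ha hc.
- move=> bx a; rewrite addE => /orP[/andP[/eqP-> _]|/sD/leqW //].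
  by rewrite valP.
Qed.

End Peel.

(** * Weights of tableaux and the branching rule *)

Section Weights.
Variables (b : R) (x : 'I_n -> R) (s : nat -> R).
Local Open Scope ring_scope.

Definition letter_weight (bx : 'I_n * 'I_k) (r : 'I_n) : R :=
  oplus b (x r) (s (r + bx.2 + 1 - bx.1)%N).

(** The power $\beta^{|T|-|\lambda|}$ is distributed over the boxes, one factor for each letter
    after the first. An empty box contributes 1, since [0.-1] is [0]. *)
Definition svt_weight T : R := \prod_bx (b ^+ #|T bx|.-1 * \prod_(r in T bx) letter_weight bx r).

Definition svt_sum p la : R := \sum_(T | svt la p T) svt_weight T.

Lemma Gfact_svt_sum (lam : seq nat) : size lam = n -> (forall i, (nth 0%N lam i <= k)%N) ->
  Gfact b k lam x s = svt_sum n (nth 0%N lam).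
Proof.
move=> sz lek; rewrite /Gfact /svt_sum; apply: eq_big => [T|T]; first exact: is_svtE.
rewrite is_svtE => /svtP[A _ _ _]; rewrite /svt_weight big_split /= prodrXr; congr (_ ^+ _ * _).
  rewrite /svt_size.
  have -> : sumn lam = (\sum_(bx : 'I_n * 'I_k) (T bx != set0))%N.
    rewrite sumnE (big_nth 0%N) sz big_mkord.
    transitivity (\sum_(i < n) \sum_(j < k) ((T (i, j) != set0) : nat))%N; last first.
      by rewrite pair_bigA; apply: eq_bigr => -[].
    apply: eq_bigr => i _; under eq_bigr do rewrite A.
    rewrite -[LHS](card_ord_lt (lek i)) -sum1dep_card big_mkcond /=.
    by apply: eq_bigr => j _; case: ltnP.
  rewrite -sumnB; last by move=> bx _; rewrite -cards_eq0; case: #|_|.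
  apply: eq_bigr => bx _; case: (altP eqP) => [->|]; first by rewrite cards0.
  by rewrite subn1.
rewrite [RHS](bigID (fun bx : 'I_n * 'I_k => in_shape lam bx.1 bx.2)) /=.
rewrite [X in _ = _ * X]big1 ?mulr1 // => -[i j] /=.
by rewrite /in_shape -A negbK => /eqP->; rewrite big_set0.
Qed.

Lemma svt_sum_empty p la : (forall i, la i = 0%N) -> svt_sum p la = 1.
Proof.
move=> la0; rewrite /svt_sum (big_pred1 [ffun=> set0]) => [|T].
  by rewrite /svt_weight big1 // => bx _; rewrite ffunE cards0 big_set0 mulr1.
apply/svtP/eqP => [[A _ _ _]|->].
  by apply/ffunP => -[i j]; rewrite ffunE; apply/eqP; rewrite -[_ == _]negbK A la0.
split=> [i j|i j1 j2 a c _|i1 i2 j a c _|bx a]; rewrite !ffunE ?inE //.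
by rewrite la0 eqxx.
Qed.

(** The factor gained at one box when [P] is adjoined there or not: in a box of [nu] the new letter
    is an additional one and costs a [b]. The admissibility indicator is included so that a sum over
    all sets of boxes factors. *)
Definition box_weight la nu (P : 'I_n) (bx : 'I_n * 'I_k) (inA : bool) : R :=
  (admissible la nu bx inA)%:R *
  (if inA then (if (bx.2 < nu bx.1)%N then b * letter_weight bx P else letter_weight bx P) else 1).

Lemma svt_weight_adjoin p (P : 'I_n) la nu T (A : {set 'I_n * 'I_k}) : (P : nat) = p -> svt nu p T ->
  [forall bx, admissible la nu bx (bx \in A)]%:R * svt_weight (adjoin P T A) =
  svt_weight T * \prod_bx box_weight la nu P bx (bx \in A).
Proof.
move=> valP svtT; rewrite /box_weight big_split /=.
have [sA _ _ _] := svtP _ _ _ svtT.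
have -> : \prod_bx (admissible la nu bx (bx \in A))%:R =
    [forall bx, admissible la nu bx (bx \in A)]%:R :> R.
  case: forallP => [h|/forallP]; first by rewrite big1 // => bx _; rewrite h.
  by rewrite negb_forall => /existsP[bx /negbTE h]; rewrite (bigD1 bx) //= h mul0r.
rewrite mulrCA; congr (_ * _); rewrite -big_split /=; apply: eq_bigr => -[i j] _.
rewrite ffunE; case: ifP => _; last by rewrite mulr1.
have nP := svt_notin valP (i, j) svtT.
rewrite cardsU1 nP big_setU1 //= -sA; case: (altP eqP) => [->|ne] /=.
  by rewrite cards0 big_set0 /= !expr0 !mul1r mulr1.
have : (0 < #|T (i, j)|)%N by rewrite card_gt0.
by case: #|_| => //= c _; rewrite exprS; ring.
Qed.

(** Tableaux are grouped by the shape left after erasing [P]. Admissibility is tested box by box, so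
    the sum over the places of [P] becomes a product of two-term sums, by [bigA_distr]. *)
Lemma branching p (P : 'I_n) la : (P : nat) = p ->
  (forall i, la i.+1 <= la i)%N -> (forall i, la i <= k)%N -> (forall i, p < i -> la i = 0)%N ->
  svt_sum p.+1 la = \sum_(mu | interlaces la mu) svt_sum p (@nat_shape p mu) *
     \prod_bx (box_weight la (nat_shape mu) P bx true +
    box_weight la (nat_shape mu) P bx false).
Proof.
move=> valP dec lek la0; rewrite /svt_sum.
rewrite (partition_big (erased_shape valP) (@interlaces p la)) /=; last first.
  by move=> T /(svt_erase valP dec lek la0) [].
apply: eq_bigr => mu intm.
rewrite (reindex_onto (fun X => adjoin P X.1 X.2)
  (fun T => (erase P T, occurrences P T))) /=; last first.
  by move=> T _; apply: adjoin_erase.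
transitivity (\sum_(X : svt_type n k * {set 'I_n * 'I_k} |
    svt (nat_shape mu) p X.1 && [forall bx, admissible la (nat_shape mu) bx (bx \in X.2)])
    svt_weight (adjoin P X.1 X.2)).
  apply: eq_bigl => -[T A] /=; apply/idP/idP.
    case/andP => /andP[svtT /eqP Dmu] /eqP[Dd Do].
    have [_ h1 h2] := svt_erase valP dec lek la0 svtT.
    by rewrite Dmu Dd Do in h1 h2; rewrite h1; apply/forallP.
  case/andP => svtT /forallP admA.
  have nP bx := svt_notin valP bx svtT.
  rewrite (svt_adjoin valP la0 intm svtT admA) erase_adjoin // occurrences_adjoin // eqxx andbT.
  apply/eqP; apply: erased_shapeE => i j; rewrite erase_adjoin //.
  by case/svtP: svtT => ->.
rewrite -(pair_big_dep (fun T => svt (nat_shape mu) p T)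
   (fun T (A : {set 'I_n * 'I_k}) => [forall bx, admissible la (nat_shape mu) bx (bx \in A)])
   (fun T A => svt_weight (adjoin P T A))) /= big_distrl /=.
apply: eq_bigr => T svtT.
rewrite bigA_distr big_distrr /= big_mkcond /=; apply: eq_bigr => A _.
have := svt_weight_adjoin la A valP svtT.
rewrite /= => /esym; case: ifP => _.
  rewrite mul1r => <-; congr (_ * _); apply: eq_bigr => bx _; by case: ifP.
rewrite mul0r => <-; congr (_ * _); apply: eq_bigr => bx _; by case: ifP.
Qed.

End Weights.
End Tableaux.

(** * The bialternant formula *)

Section DetSums.
Variable R : comNzRingType.

(** Multilinearity in all rows at once. It applies to the branching rule because interlacing
    restricts each row of the inner shape independently. *)
Lemma det_sum_rows p (J : finType) (D : 'I_p -> pred J) (w : 'I_p -> J -> R)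
    (v : 'I_p -> J -> 'I_p -> R) :
  \sum_(f in family D) (\det (\matrix_(i, j) v i (f i) j) * \prod_i w i (f i)) =
  \det (\matrix_(i, j) \sum_(m | D i m) w i m * v i m j).
Proof.
under eq_bigr do rewrite big_distrl /=.
rewrite exchange_big /=; apply: eq_bigr => t _.
transitivity ((-1) ^+ t * \prod_i \sum_(m | D i m) w i m * v i m (t i)); last first.
  by congr (_ * _); apply: eq_bigr => i _; rewrite mxE.
rewrite bigA_distr_big_dep big_distrr /=; apply: eq_bigr => f _.
rewrite -mulrA -big_split /=; congr (_ * _).
by apply: eq_bigr => i _; rewrite mxE mulrC.
Qed.

Lemma det_scale_cols p (d : 'I_p -> R) (A : 'M[R]_p) :
  \det (\matrix_(i, j) (d j * A i j)) = (\prod_j d j) * \det A.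
Proof.
rewrite /determinant big_distrr /=; apply: eq_bigr => t _.
rewrite mulrCA; congr (_ * _).
rewrite [in RHS](reindex_inj (@perm_inj _ t)) /= -big_split /=.
by apply: eq_bigr => i _; rewrite mxE.
Qed.

(* Adding to each row but the last a multiple of the next one, after scaling
   it by a, so as to clear the last column above the diagonal. *)
Lemma det_clear_last_col p (M : 'M[R]_p.+1) (a : R) (c : 'I_p -> R) :
  (forall i : 'I_p, a * M (widen_ord (leqnSn p) i) ord_max = c i * M (lift ord0 i) ord_max) ->
  a ^+ p * \det M = M ord_max ord_max *
    \det (\matrix_(i < p, j < p) (a * M (widen_ord (leqnSn p) i) (widen_ord (leqnSn p) j)
             - c i * M (lift ord0 i) (widen_ord (leqnSn p) j))).
Proof.
move=> cM.
(* [L] is upper bidiagonal, with [a] on the diagonal except for a final 1 and [- c i] just above it;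
   left multiplication by it performs the row operations. *)
pose L : 'M[R]_p.+1 := \matrix_(i, j)
  (if insub (i : nat) is Some i' then a *+ (j == i) - c i' *+ (j == lift ord0 i')
   else (j == i)%:R).
have insw (i : 'I_p) : insub (widen_ord (leqnSn p) i : nat) = Some i by rewrite /= valK.
have insm : insub (@ord_max p : nat) = None :> option 'I_p by rewrite insubF //= ltnn.
have detL : \det L = a ^+ p.
  rewrite -det_tr det_trig; last first.
    apply/is_trig_mxP => i j ltij; rewrite !mxE; case: insubP => [j' _ Dj|_].
      rewrite -!(inj_eq val_inj) /= /bump /= Dj.
      by rewrite (ltn_eqF ltij) (ltn_eqF (leqW ltij)) !mulr0n subr0.
    by rewrite -(inj_eq val_inj) (ltn_eqF ltij).
  rewrite big_ord_recr /= !mxE insm eqxx mulr1.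
  rewrite -[p in RHS]card_ord -prodr_const; apply: eq_bigr => i _.
  rewrite !mxE insw eqxx -(inj_eq val_inj) /= /bump /= add1n.
  by rewrite (ltn_eqF (ltnSn i)) mulr0n subr0.
have LMw i j : (L *m M) (widen_ord (leqnSn p) i) j =
    a * M (widen_ord (leqnSn p) i) j - c i * M (lift ord0 i) j.
  rewrite mxE; under eq_bigr do rewrite mxE insw mulrBl !mulrnAl.
  rewrite big_split /= sumrN; congr (_ - _).
    by rewrite (bigD1 (widen_ord (leqnSn p) i)) //= eqxx big1 ?addr0 // => l /negbTE->.
  by rewrite (bigD1 (lift ord0 i)) //= eqxx big1 ?addr0 // => l /negbTE->.
have LMm j : (L *m M) ord_max j = M ord_max j.
  rewrite mxE; under eq_bigr do rewrite mxE insm.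
  by rewrite (bigD1 ord_max) //= eqxx mul1r big1 ?addr0 // => l /negbTE->; rewrite mul0r.
have liftw (i : 'I_p) : lift ord_max i = widen_ord (leqnSn p) i.
  by apply: val_inj; rewrite /= /bump leqNgt ltn_ord.
rewrite -detL -det_mulmx (expand_det_col _ ord_max) big_ord_recr /= big1 ?add0r => [|i _].
  rewrite LMm /cofactor -signr_odd oddD addbb mul1r; congr (_ * \det _).
  by apply/matrixP => i j; rewrite !mxE !liftw -LMw mxE.
by rewrite LMw cM subrr mul0r.
Qed.

End DetSums.

Section Bialternant.
Variables (R : idomainType) (n k : nat) (b : R) (x : 'I_n -> R) (s : nat -> R).

(** The factorial power $[z|s]^a$ of the bialternant formula. *)
Definition fact_pow (z : R) (a : nat) : R := \prod_(l < a) oplus b z (s l.+1).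

Definition alt_entry (la : nat -> nat) (p i : nat) (z : R) : R :=
  fact_pow z (la i + (p - i.+1)) * (1 + b * z) ^+ i.

(** The share of row [i] in the branching coefficient, for $e=p-i-1$, $B=\lambda_{i+1}$,
    $A=\lambda_i$, $m=\mu_i$. The boxes from [m] to [A] must carry the new letter; the last box of
    $\mu$ may carry it when no box of $\lambda$ lies below, that is when [B < m]. *)
Definition row_weight (z : R) (e B A m : nat) : R :=
  (\prod_(m <= j < A) oplus b z (s (e.+1 + j).+1)) *
  (if (B < m)%N then 1 + b * oplus b z (s (e + m).+1) else 1).

Lemma fact_powS z a : fact_pow z a.+1 = fact_pow z a * oplus b z (s a.+1).
Proof. by rewrite /fact_pow big_ord_recr. Qed.

(** Induction on [A - B]: raising [A] by one multiplies the old terms by a common factor and adds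
    one term. After multiplication by $(1+by)^i$ the right side combines rows [i] and [i + 1] of the
    determinant for [p + 1] letters. *)
Lemma telescope_row (y z : R) e B A : (B <= A)%N ->
  (y - z) * (\sum_(B <= m < A.+1) row_weight z e B A m * fact_pow y (m + e)) =
  (1 + b * z) * fact_pow y (A + e.+1)
  - (\prod_(B + e <= l < A + e.+1) oplus b z (s l.+1)) * ((1 + b * y) * fact_pow y (B + e)).
Proof.
move=> leBA; rewrite -(subnKC leBA); elim: (A - B)%N => [|d IHd].
  rewrite addn0 big_nat1 /row_weight big_geq // ltnn addnS big_nat1 fact_powS /oplus; ring.
rewrite addnS big_nat_recr ?leqW ?leq_addr //=.
have -> : \sum_(B <= m < (B + d).+1) row_weight z e B (B + d).+1 m * fact_pow y (m + e) =
    oplus b z (s (B + d + e.+1).+1) *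
    \sum_(B <= m < (B + d).+1) row_weight z e B (B + d) m * fact_pow y (m + e).
  rewrite big_distrr /=; apply: eq_big_nat => m /andP[_ ltm].
  rewrite /row_weight big_nat_recr //= [(e.+1 + _)%N]addnC; ring.
rewrite mulrDr mulrCA IHd !addSn !addnS (fact_powS _ (B + d + e).+1).
rewrite [in RHS]big_nat_recr /=; last by rewrite ltnW // ltnS leq_add2r leq_addr.
have -> : row_weight z e B (B + d).+1 (B + d).+1 = 1 + b * oplus b z (s (B + d + e).+2).
  by rewrite /row_weight big_geq // ltnS leq_addr mul1r !addnS [(e + _)%N]addnC.
rewrite /oplus; ring.
Qed.

Let X (i : nat) : R := oapp x 0 (insub i).

(** The product is regrouped by rows. Row [p] of [mu] is empty, so all boxes of [la] there carry the
    new letter and give a full factorial power; later rows are empty. *)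
Lemma prod_box p (P : 'I_n) la mu : (P : nat) = p ->
  (forall i, la i.+1 <= la i)%N -> (forall i, la i <= k)%N -> (forall i, p < i -> la i = 0)%N ->
  interlaces la mu ->
  \prod_(bx : 'I_n * 'I_k) (box_weight b x s la (@nat_shape k p mu) P bx true +
    box_weight b x s la (@nat_shape k p mu) P bx false) =
  fact_pow (X p) (la p) * \prod_(i < p) row_weight (X p) (p - i.+1) (la i.+1) (la i) (mu i).
Proof.
move=> valP dec lek la0 intm.
have im := interlacesP la0 intm.
have XP : X p = x P by rewrite /X -valP valK.
pose nu := nat_shape mu.
(* The two weights at a box add up to [w] where the new letter is forced, to [1 + b * w] where it is
   optional, and to 1 elsewhere. *)
pose F (i j : nat) : R :=
  let w := oplus b (x P) (s (p + j + 1 - i)%N) in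
  if (j < nu i)%N then (if (j.+1 == nu i) && (la i.+1 <= j)%N then 1 + b * w else 1)
  else if (j < la i)%N then w else 1.
have rowF (i : nat) : (i <= p)%N -> \prod_(j < k) F i j =
    (\prod_(nu i <= j < la i) oplus b (x P) (s (p - i + j).+1)) *
    (if (la i.+1 < nu i)%N then 1 + b * oplus b (x P) (s (p - i + nu i)%N) else 1).
  move=> leip; have [h1 h2] := im i.
  rewrite -(big_mkord xpredT (F i)) (@big_cat_nat _ _ _ (nu i)) //=; last exact: leq_trans h2 (lek i).
  rewrite mulrC (@big_cat_nat _ _ _ (la i)) ?lek //=
    [X in _ * X * _]big_nat [X in _ * X * _]big1 ?mulr1; last first.
    by move=> j /andP[lej _]; rewrite /F ltnNge (leq_trans h2 lej) /= ltnNge lej.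
  congr (_ * _).
    apply: eq_big_nat => j /andP[lej ltj]; rewrite /F ltnNge lej /= ltj.
    by congr (oplus b _ (s _)); lia.
  rewrite /F; case: (nu i) => [|m]; first by rewrite big_geq.
  rewrite big_nat_recr //= big_nat big1 ?mul1r; last first.
    by move=> j /andP[_ ltj]; rewrite ltnS (ltnW ltj) eqSS (ltn_eqF ltj).
  rewrite ltnSn eqxx /= ltnS; case: ifP => // _.
  by congr (1 + b * oplus b _ (s _)); lia.
transitivity (\prod_(i < n) \prod_(j < k) F i j).
  rewrite pair_bigA; apply: eq_bigr => -[i j] _.
  rewrite /box_weight /admissible /F /letter_weight /= valP.
  case: ifP => _ /=.
    by case: ifP => _ /=; rewrite ?mul1r ?mul0r ?add0r // addrC.
  by case: ifP => _ /=; rewrite ?mul1r ?mul0r ?addr0 ?add0r.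
have lepn : (p.+1 <= n)%N by rewrite -valP.
rewrite -(big_mkord xpredT (fun i => \prod_(j < k) F i j)) (@big_cat_nat _ _ _ p.+1) //=.
rewrite [X in _ * X]big_nat [X in _ * X]big1 ?mulr1; last first.
  move=> i /andP[lti _]; apply: big1 => j _.
  by rewrite /F /nu (nat_shape_geq mu (ltnW lti)) (la0 _ lti).
rewrite big_mkord big_ord_recr /= mulrC rowF // subnn XP {1 2 3}/nu nat_shape_geq //= mulr1.
congr (_ * _); first by rewrite big_mkord.
apply: eq_bigr => i _; rewrite rowF ?(ltnW (ltn_ord i)) // /nu nat_shape_ord /row_weight subnSK //.
congr (_ * _); case: ifP => // lt0.
by congr (1 + b * oplus b _ (s _)); move: (ltn_ord i); lia.
Qed.

Definition vandermonde_prod (p : nat) : R := \prod_(j < p) \prod_(i < j) (X i - X j).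

Lemma bialternant_letters p la : (p <= n)%N -> (forall i, 1 + b * X i != 0) ->
  (forall i, la i.+1 <= la i)%N -> (forall i, la i <= k)%N -> (forall i, p <= i -> la i = 0)%N ->
  vandermonde_prod p * svt_sum k b x s p la = \det (\matrix_(i < p, j < p) alt_entry la p i (X j)).
Proof.
move=> lepn nz; elim: p lepn la => [|p IHp] ltpn la dec lek la0.
  by rewrite det_mx00 /vandermonde_prod big_ord0 mul1r svt_sum_empty // => i; apply: la0.
have la0' i : (p < i)%N -> la i = 0%N by apply: la0.
pose P := Ordinal ltpn; pose z := X p.
rewrite (@branching _ _ _ b x s p P la erefl dec lek la0').
rewrite /vandermonde_prod big_ord_recr /= -/(vandermonde_prod p).
have -> : \sum_(mu | interlaces la mu) svt_sum k b x s p (@nat_shape k p mu) *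
     \prod_(bx : 'I_n * 'I_k) (box_weight b x s la (nat_shape mu) P bx true +
    box_weight b x s la (nat_shape mu) P bx false) =
   fact_pow z (la p) * \sum_(mu : {ffun 'I_p -> 'I_k.+1} | interlaces la mu)
     (svt_sum k b x s p (nat_shape mu) *
     \prod_(i < p) row_weight z (p - i.+1) (la i.+1) (la i) (mu i)).
  rewrite big_distrr /=; apply: eq_bigr => mu intm.
  by rewrite (@prod_box p P la mu erefl dec lek la0' intm) mulrCA.
rewrite mulrACA [_ * fact_pow _ _]mulrC -mulrA [X in _ * X]mulrCA.
have -> : vandermonde_prod p * \sum_(mu : {ffun 'I_p -> 'I_k.+1} | interlaces la mu)
     (svt_sum k b x s p (nat_shape mu) *
     \prod_(i < p) row_weight z (p - i.+1) (la i.+1) (la i) (mu i)) =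
  \det (\matrix_(i < p, j < p) \sum_(m : 'I_k.+1 | (la i.+1 <= m <= la i)%N)
     row_weight z (p - i.+1) (la i.+1) (la i) m *
     (fact_pow (X j) (m + (p - i.+1)) * (1 + b * X j) ^+ i)).
  rewrite -(@det_sum_rows _ _ _ (fun i : 'I_p => fun m : 'I_k.+1 => (la i.+1 <= m <= la i)%N)
    (fun i m => row_weight z (p - i.+1) (la i.+1) (la i) m)
    (fun i m j => fact_pow (X j) (m + (p - i.+1)) * (1 + b * X j) ^+ i)).
  rewrite big_distrr /=; apply: eq_big => [mu|mu intm].
    by apply/forallP/familyP => h i; apply: h.
  have im := interlacesP la0' intm.
  rewrite mulrA IHp ?(ltnW ltpn) //.
  - congr (\det _ * _); apply/matrixP => i j; rewrite !mxE /alt_entry.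
    by rewrite nat_shape_ord.
  - by move=> i; have [h1 _] := im i; have [_ h2] := im i.+1; apply: leq_trans h1.
  - by move=> i; apply: nat_shape_le.
  - by move=> i; apply: nat_shape_geq.
(* The new factors [X j - z] of the Vandermonde product scale the columns, which produces the left
   side of [telescope_row] in every entry. *)
rewrite -det_scale_cols.
pose w := widen_ord (leqnSn p).
pose c (i : 'I_p) := \prod_(la i.+1 + (p - i.+1) <= l < la i + (p - i)) oplus b z (s l.+1).
have lastE i : alt_entry la p.+1 i z = fact_pow z (la i + (p - i)) * (1 + b * z) ^+ i.
  by rewrite /alt_entry subSS.
pose M := \matrix_(i < p.+1, j < p.+1) alt_entry la p.+1 i (X j).
have clr (i : 'I_p) : (1 + b * z) * M (w i) ord_max = c i * M (lift ord0 i) ord_max.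
  rewrite !mxE /= -/z !lastE /bump /= add1n exprS mulrCA mulrA.
  have -> : fact_pow z (la i + (p - i)) = fact_pow z (la i.+1 + (p - i.+1)) * c i.
    rewrite /fact_pow -!(big_mkord xpredT (fun l => oplus b z (s l.+1))) -big_cat_nat //=.
    by apply: leq_add; rewrite ?dec // leq_sub2l.
  ring.
have H := det_clear_last_col clr; rewrite {2}/M mxE /= -/z lastE subnn addn0 in H.
(* The corner entry of [M] equals [fact_pow z (la p)] times the same power of [1 + b * z] that the
   row operations introduced; this nonzero power cancels. *)
apply: (mulfI (expf_neq0 p (nz p))); rewrite -/z -/M H [RHS]mulrAC [RHS]mulrC.
congr (_ * (_ * \det _)); apply/matrixP => i j; rewrite !mxE /= -/z.
have ltip := ltn_ord i.
rewrite /alt_entry /bump /= add1n subSS.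
have -> : \sum_(m < k.+1 | (la i.+1 <= m <= la i)%N)
     row_weight z (p - i.+1) (la i.+1) (la i) m *
     (fact_pow (X j) (m + (p - i.+1)) * (1 + b * X j) ^+ i) =
  (\sum_(la i.+1 <= m < (la i).+1) row_weight z (p - i.+1) (la i.+1) (la i) m *
     fact_pow (X j) (m + (p - i.+1))) * (1 + b * X j) ^+ i.
  rewrite big_distrl /= (@big_nat_widen _ _ _ _ _ k.+1) ?ltnS ?lek // big_geq_mkord /=.
  by apply: eq_big => [m|m _]; rewrite ?mulrA // ltnS andbC.
rewrite mulrA telescope_row // subnSK // /c exprS; ring.
Qed.

End Bialternant.

(** * Divided differences in the parameters *)

Lemma swapnK j : involutive (swapn j).
Proof. by move=> c; rewrite /swapn; do !case: eqP => //; lia. Qed.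

(** * Index sets of partitions and the action of $s_j$ *)

Section Partitions.
Local Open Scope nat_scope.
Variables (n k : nat).
Implicit Types (lam S : seq nat).

(** In 1-based terms this is the exponent $\lambda_i+n-i$ of the bialternant formula. The successors
    of these numbers make up $I_\lambda$, so $j+1\in I_\lambda$ means that some row has exponent
    $j$. *)
Definition strict_part lam (i : nat) : nat := nth 0 lam i + (n - i.+1).

Lemma in_boxP lam : in_box n k lam ->
  [/\ size lam = n, forall i, nth 0 lam i.+1 <= nth 0 lam i & forall i, nth 0 lam i <= k].
Proof.
case/and3P => /eqP sz /(sortedP 0) srt /(all_nthP 0) lek; split=> // i.
  by case: (ltnP i.+1 (size lam)) => [/srt//|/(nth_default 0)->].
by case: (ltnP i (size lam)) => [/lek//|/(nth_default 0)->].
Qed.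

Lemma strict_part_decr lam i j : in_box n k lam -> i < j < n -> strict_part lam j < strict_part lam i.
Proof.
move=> /in_boxP[_ dec _] /andP[ltij ltjn].
have le : nth 0 lam j <= nth 0 lam i.
  elim: j ltij {ltjn} => // j IH; rewrite ltnS leq_eqVlt => /orP[/eqP<- //|/IH].
  exact: leq_trans (dec j).
by rewrite /strict_part; lia.
Qed.

Lemma strict_part_inj lam i j : in_box n k lam -> i < n -> j < n ->
  strict_part lam i = strict_part lam j -> i = j.
Proof.
move=> box ltin ltjn e; case: (ltngtP i j) => // lt.
  by have := @strict_part_decr lam i j box; rewrite lt ltjn e ltnn => /(_ isT).
by have := @strict_part_decr lam j i box; rewrite lt ltin e ltnn => /(_ isT).
Qed.

Lemma size_Iseq lam : size (Iseq n lam) = n.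
Proof. by rewrite size_map size_iota. Qed.

Lemma nth_Iseq lam l : l < n -> nth 0 (Iseq n lam) l = (strict_part lam (n - l.+1)).+1.
Proof.
move=> ltln; rewrite (nth_map 0) ?size_iota // nth_iota // /strict_part add1n; lia.
Qed.

Lemma mem_Iseq lam c : reflect (exists2 i, i < n & (strict_part lam i).+1 = c) (c \in Iseq n lam).
Proof.
apply: (iffP (nthP 0)); rewrite size_Iseq => -[l ltln <-].
  by exists (n - l.+1); [lia | rewrite nth_Iseq].
exists (n - l.+1); first by lia.
by rewrite nth_Iseq; [congr (strict_part _ _).+1; lia | lia].
Qed.

Lemma Iseq_sorted lam : in_box n k lam -> sorted ltn (Iseq n lam).
Proof.
move=> box; apply/(sortedP 0) => l; rewrite size_Iseq => lt.
rewrite !nth_Iseq ?(ltnW lt) //= ltnS; apply: strict_part_decr => //; lia.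
Qed.

Lemma Iseq_range lam c : in_box n k lam -> c \in Iseq n lam -> 1 <= c <= n + k.
Proof.
by case/in_boxP => _ _ lek /mem_Iseq[i lti <-] /=; have := lek i; rewrite /strict_part; lia.
Qed.

Section LamOf.
Variable S : seq nat.
Hypotheses (srt : sorted ltn S) (sz : size S = n) (rng : forall c, c \in S -> 1 <= c <= n + k).

Lemma sorted_gap l m : l <= m < n -> nth 0 S l + (m - l) <= nth 0 S m.
Proof.
case/andP => lelm; rewrite -(subnKC lelm) addKn; elim: (m - l) => [|d IHd] ltn.
  by rewrite !addn0.
have lt1 : l + d < n by lia.
have := IHd lt1; have := (sortedP 0 srt) (l + d); rewrite sz -addnS => /(_ ltn) /=; lia.
Qed.

(** The gaps are measured from both ends of [S]. The lower bound makes the truncated subtraction in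
    [lam_of] exact, the upper one keeps the parts at most [k]. *)
Lemma sorted_bounds l : l < n -> l < nth 0 S l <= k + l.+1.
Proof.
move=> ltln.
have ltn0 : 0 < size S by rewrite sz; lia.
have ltn1 : n.-1 < size S by rewrite sz; lia.
have g0 : 0 < nth 0 S 0 by case/andP: (rng (mem_nth 0 ltn0)).
have gn : nth 0 S n.-1 <= n + k by case/andP: (rng (mem_nth 0 ltn1)).
have r1 : l <= n.-1 < n by lia.
have h1 := sorted_gap r1; have h0 := @sorted_gap 0 l ltln.
by apply/andP; split; lia.
Qed.

Lemma nth_lam_of i : i < n -> nth 0 (lam_of n S) i = nth 0 S (n - i.+1) - (n - i).
Proof.
move=> ltin; rewrite /lam_of nth_rev size_map size_iota //.
rewrite (nth_map 0) ?size_iota ?nth_iota ?add0n; [congr (_ - _)|..]; lia.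
Qed.

Lemma lam_ofK : Iseq n (lam_of n S) = S.
Proof.
apply: (@eq_from_nth _ 0); rewrite size_Iseq // => l ltln.
rewrite nth_Iseq // /strict_part nth_lam_of; last by lia.
have -> : n - (n - l.+1).+1 = l by lia.
by have := sorted_bounds ltln; lia.
Qed.

Lemma lam_of_box : in_box n k (lam_of n S).
Proof.
have szl : size (lam_of n S) = n by rewrite size_rev size_map size_iota.
apply/and3P; split; first exact/eqP.
  apply/(sortedP 0) => i; rewrite szl => lt; rewrite /geq /= !nth_lam_of //; last by lia.
  have := @sorted_gap (n - i.+2) (n - i.+1); lia.
apply/(all_nthP 0) => i; rewrite szl => lt; rewrite nth_lam_of //.
by have := @sorted_bounds (n - i.+1); lia.
Qed.

End LamOf.

Variable j : nat.
Hypotheses (j1 : 1 <= j) (jN : j <= n + k - 1).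

Section SjPart.
Variable lam : seq nat.
Hypothesis box : in_box n k lam.

Let S := sort leq (map (swapn j) (Iseq n lam)).

Lemma swap_sorted : sorted ltn S.
Proof.
rewrite ltn_sorted_uniq_leq sort_sorted ?andbT; last exact: leq_total.
rewrite sort_uniq (map_inj_uniq (can_inj (@swapnK j))).
exact: sorted_uniq ltn_trans ltnn _ (Iseq_sorted box).
Qed.

Lemma swap_size : size S = n.
Proof. by rewrite size_sort size_map size_Iseq. Qed.

Lemma swap_range c : c \in S -> 1 <= c <= n + k.
Proof.
rewrite mem_sort => /mapP[c' /(Iseq_range box) h ->]; rewrite /swapn.
by do !case: eqP => //; lia.
Qed.

Lemma sj_part_box : in_box n k (sj_part n j lam).
Proof. exact: lam_of_box swap_sorted swap_size swap_range. Qed.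

Lemma Iseq_sj_part : Iseq n (sj_part n j lam) = S.
Proof. exact: lam_ofK swap_sorted swap_size swap_range. Qed.

Lemma mem_Iseq_sj_part c : (swapn j c \in Iseq n (sj_part n j lam)) = (c \in Iseq n lam).
Proof. by rewrite Iseq_sj_part mem_sort mem_map //; exact: can_inj (@swapnK j). Qed.

(* Since j is not an index, lowering j + 1 to j keeps the index list sorted. *)
Lemma strict_part_sj_part i : j \notin Iseq n lam -> i < n ->
  (strict_part (sj_part n j lam) i).+1 = swapn j (strict_part lam i).+1.
Proof.
move=> nj ltin; have lt' : n - i.+1 < n by lia.
have e : n - (n - i.+1).+1 = i by lia.
have := nth_Iseq (sj_part n j lam) lt'; rewrite e => <-.
rewrite Iseq_sj_part /S sorted_sort; [|exact: leq_trans|].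
  by rewrite (nth_map 0) ?size_Iseq // nth_Iseq // e.
rewrite sorted_map.
apply: (@sub_in_sorted _ (mem (Iseq n lam)) ltn) (Iseq_sorted box); last exact/allP.
move=> a c Ia Ic /= lt; rewrite /swapn.
have : a != j by apply: contraNneq nj => <-.
by do !case: eqP => //; lia.
Qed.

End SjPart.
End Partitions.

(** * Exchanging two consecutive parameters of G *)

Section DividedDifference.
Variables (R : idomainType) (n k : nat) (b : R).
Implicit Types (x : 'I_n -> R) (s : nat -> R) (lam : seq nat).

Definition altmx lam x s : 'M[R]_n :=
  \matrix_(i, j) (fact_pow b s (x j) (strict_part n lam i) * (1 + b * x j) ^+ i).

Lemma bialternant lam x s : in_box n k lam -> (forall i, 1 + b * x i != 0) ->
  vandermonde_prod x n * Gfact b k lam x s = \det (altmx lam x s).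
Proof.
move=> box nz; have [sz dec lek] := in_boxP box.
rewrite Gfact_svt_sum // (bialternant_letters s (leqnn n)) //.
- by congr (\det _); apply/matrixP => i j; rewrite !mxE valK.
- by move=> i; case: insub => //=; rewrite mulr0 addr0 oner_neq0.
- by move=> i lei; rewrite nth_default ?sz.
Qed.

(** The bialternant formula for the empty partition, where G is 1. It gives the Vandermonde product
    the sign rule of a determinant. *)
Lemma vandermonde_prod_altmx x s : (forall i, 1 + b * x i != 0) ->
  vandermonde_prod x n = \det (altmx (nseq n 0%N) x s).
Proof.
move=> nz; rewrite -bialternant ?Gfact_svt_sum ?svt_sum_empty ?mulr1 ?size_nseq //;
  try by move=> i; rewrite nth_nseq if_same.
rewrite /in_box size_nseq eqxx /=; apply/andP; split.
  by apply/(sortedP 0%N) => i _; rewrite /geq /= !nth_nseq !if_same.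
by apply/allP => c /nseqP[->].
Qed.

Lemma vandermonde_prod_neq0 x : injective x -> vandermonde_prod x n != 0.
Proof.
move=> injx; apply/prodf_neq0 => j _; apply/prodf_neq0 => i _.
have ltin : (i < n)%N by apply: ltn_trans (ltn_ord i) (ltn_ord j).
rewrite subr_eq0 valK (insubT (fun m => m < n)%N ltin) /=.
by apply/eqP => /injx /(congr1 val) /= e; have := ltn_ord i; rewrite e ltnn.
Qed.

Lemma altmx_perm lam x s (t : 'S_n) :
  \det (altmx lam (x \o t) s) = (-1) ^+ t * \det (altmx lam x s).
Proof.
have E : (altmx lam (x \o t) s)^T = row_perm t (altmx lam x s)^T.
  by apply/matrixP => i j; rewrite !mxE.
by rewrite -det_tr E row_permE det_mulmx det_perm det_tr.
Qed.

(** The determinant and the Vandermonde product both change by the sign of [t]; injectivity of [x]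
    allows division by the latter. *)
Lemma Gfact_perm lam x s (t : 'S_n) : in_box n k lam -> (forall i, 1 + b * x i != 0) ->
  injective x -> Gfact b k lam (x \o t) s = Gfact b k lam x s.
Proof.
move=> box nz injx; have nz' i : 1 + b * (x \o t) i != 0 by apply: nz.
have injxt : injective (x \o t) by apply: inj_comp => //; apply: perm_inj.
apply: (mulfI (vandermonde_prod_neq0 injxt)); rewrite bialternant // altmx_perm.
by rewrite (vandermonde_prod_altmx s nz') altmx_perm -mulrA -(vandermonde_prod_altmx s nz) bialternant.
Qed.

Section Swap.
Variables (x : 'I_n -> R) (s s' : nat -> R) (j : nat) (kappa : R).
Hypotheses (j1 : (1 <= j)%N) (jN : (j <= n + k - 1)%N).
Hypotheses (nz : forall i, 1 + b * x i != 0) (injx : injective x).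
Hypotheses (Ds' : forall c, s' c = s (swapn j c)).
(** So [kappa] is $s_{j+1}\ominus s_j$, expressed without division in the domain [R]. For $s=\ominus
    t$ it becomes $t_j\ominus t_{j+1}$. *)
Hypothesis Dk : s j.+1 - s j = kappa * (1 + b * s j).

(** If [a < j], neither exchanged parameter occurs; if [a > j], both do and the product is merely
    reordered. *)
Lemma fact_pow_swap z a : a != j -> fact_pow b s' z a = fact_pow b s z a.
Proof.
move=> neaj; rewrite /fact_pow; case: (ltnP a j) => [ltaj|leja].
  apply: eq_bigr => l _; rewrite Ds' /swapn; have := ltn_ord l.
  by do !case: eqP => //; lia.
have ltja : (j < a)%N by rewrite ltn_neqAle eq_sym neaj.
have ltja' : (j.-1 < a)%N by lia.
rewrite (reindex_inj (@perm_inj _ (tperm (Ordinal ltja') (Ordinal ltja)))) /=.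
apply: eq_bigr => l _; congr (oplus b z _); rewrite Ds'; congr s; rewrite /swapn.
case: tpermP => [->|->|/eqP h1 /eqP h2] /=; last rewrite -!(inj_eq val_inj) /= in h1 h2.
- by do !case: eqP => //; lia.
- by do !case: eqP => //; lia.
- by do !case: eqP => //; lia.
Qed.

Lemma fact_pow_pred r z : fact_pow b r z j = fact_pow b r z j.-1 * oplus b z (r j).
Proof.
have Dj : j.-1.+1 = j by lia.
by rewrite -[in LHS]Dj fact_powS Dj.
Qed.

(** Only the last factor changes, and it grows by $\kappa(1+bs_j)(1+bz)=\kappa(1+b(z\oplus
    s_j))$. *)
Lemma fact_pow_swap_eq z : fact_pow b s' z j =
  fact_pow b s z j + kappa * (b * fact_pow b s z j + fact_pow b s z j.-1).
Proof.
rewrite !fact_pow_pred fact_pow_swap; last by lia.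
have -> : s' j = s j + kappa * (1 + b * s j) by rewrite -Dk Ds' /swapn eqxx; ring.
rewrite /oplus; ring.
Qed.

Lemma Gfact_swap lam : in_box n k lam ->
  Gfact b k lam x s' - Gfact b k lam x s =
  if (j \notin Iseq n lam) && (j.+1 \in Iseq n lam)
  then kappa * (b * Gfact b k lam x s + Gfact b k (sj_part n j lam) x s) else 0.
Proof.
move=> box; have Vnz := vandermonde_prod_neq0 injx.
apply: (mulfI Vnz); rewrite mulrBr !bialternant //.
case: (boolP (j.+1 \in _)) => [|nI]; rewrite ?andbT ?andbF; last first.
  rewrite mulr0; apply/eqP; rewrite subr_eq0; apply/eqP; congr (\det _).
  apply/matrixP => i l; rewrite !mxE fact_pow_swap //.
  by apply: contra nI => /eqP e; apply/mem_Iseq; exists i; rewrite ?e.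
case/mem_Iseq => p' ltp [ep]; pose p := Ordinal ltp.
have nep (i : 'I_n) : i != p -> strict_part n lam i != j.
  apply: contra => /eqP e; apply/eqP/val_inj => /=.
  by apply: (strict_part_inj box) => //; rewrite e ep.
(* Row [p] is the only one with exponent [j]; [r] is that row with its exponent lowered to [j - 1].
   If [j] is not an index, [Mr] is the matrix of [sj_part n j lam]. *)
pose r := \row_l (fact_pow b s (x l) j.-1 * (1 + b * x l) ^+ p).
pose Mr := \matrix_(i, l) (if i == p then r 0 l else altmx lam x s i l).
have detE : \det (altmx lam x s') = (1 + kappa * b) * \det (altmx lam x s) + kappa * \det Mr.
  apply: (@determinant_multilinear _ _ _ _ _ p).
  - apply/rowP => l; rewrite !mxE eqxx /= ep fact_pow_swap_eq; ring.
  - by apply/matrixP => i l; rewrite !mxE fact_pow_swap // nep // eq_sym neq_lift.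
  - apply/matrixP => i l; rewrite !mxE eq_sym (negbTE (neq_lift _ _)) fact_pow_swap // nep //.
    by rewrite eq_sym neq_lift.
case: (boolP (j \in _)) => [/mem_Iseq[q ltq eq]|nj] /=; last first.
  rewrite mulrCA mulrDr mulrCA !bialternant //; last exact: sj_part_box.
  have -> : altmx (sj_part n j lam) x s = Mr.
    apply/matrixP => i l; rewrite !mxE; have := strict_part_sj_part j1 jN box nj (ltn_ord i).
    case: (altP (i =P p)) => [->|ne].
      rewrite /= ep /swapn eqxx; case: eqP => [|_ e]; first by lia.
      by rewrite -[strict_part n (sj_part n j lam) p']succnK e.
    have nej := nep _ ne; rewrite /swapn eqSS (negbTE nej).
    by case: eqP => [e|_ [->] //]; case/negP: nj; apply/mem_Iseq; exists i.
  rewrite detE; ring.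
rewrite mulr0 detE.
(* The exponents decrease strictly and take the consecutive values [j] and [j - 1] at [p'] and [q],
   so these rows are adjacent. *)
have Dq : q = p'.+1.
  have ltpq : (p' < q)%N.
    rewrite ltnNge leq_eqVlt; apply/norP; split.
      by apply/eqP => e; move: eq; rewrite e ep; lia.
    by apply/negP => lt; have := @strict_part_decr n k lam q p' box; rewrite lt ltp => /(_ isT); lia.
  apply/eqP; rewrite eqn_leq ltpq andbT leqNgt; apply/negP => lt.
  have h1 := @strict_part_decr n k lam p'.+1 q box; have h2 := @strict_part_decr n k lam p' p'.+1 box.
  rewrite lt ltq in h1; rewrite ltnSn /= (ltn_trans lt ltq) in h2.
  by have := h1 isT; have := h2 isT; lia.
pose Q := Ordinal ltq.
have pq : p != Q by rewrite -(inj_eq val_inj) /= Dq neq_ltn ltnSn.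
(* Row p + 1 is row p of the swap's increment up to a scalar, so that
   increment does not contribute to the determinant. *)
have : 0 = b * \det (altmx lam x s) + \det Mr.
  pose B := \matrix_(i, l) (if i == p then altmx lam x s Q l else altmx lam x s i l).
  (* Row [Q] times $1+bs_j$ is [b] times row [p] plus [r], because $(1+bz)(1+bs_j)=1+b(z\oplus
     s_j)$. The matrix [B] has two equal rows. *)
  have : (1 + b * s j) * \det B = b * \det (altmx lam x s) + \det Mr.
    rewrite -[\det Mr]mul1r.
    pose B' := \matrix_(i, l) (if i == p then (1 + b * s j) * altmx lam x s Q l else altmx lam x s i l).
    transitivity (\det B').
      have rB : row' p B = row' p B'.
        by apply/matrixP => i l; rewrite !mxE eq_sym (negbTE (neq_lift _ _)).
      rewrite (@determinant_multilinear _ _ B' B B p (1 + b * s j) 0) ?mul0r ?addr0 //.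
      by apply/rowP => l; rewrite !mxE eqxx mul0r addr0.
    apply: (@determinant_multilinear _ _ _ _ _ p).
    - apply/rowP => l; rewrite !mxE eqxx /= ep -[strict_part n lam q]succnK eq Dq exprS.
      rewrite (fact_pow_pred s) /oplus /=.
      ring.
    - by apply/matrixP => i l; rewrite !mxE eq_sym (negbTE (neq_lift _ _)).
    - by apply/matrixP => i l; rewrite !mxE eq_sym (negbTE (neq_lift _ _)).
  rewrite (@determinant_alternate _ _ B p Q pq) ?mulr0 // => l.
  by rewrite !mxE eqxx eq_sym (negbTE pq).
move=> e; transitivity (kappa * (b * \det (altmx lam x s) + \det Mr)); first by ring.
by rewrite -e mulr0.
Qed.

End Swap.
End DividedDifference.

(** * The action on coefficients *)

Section FracMap.
Variables (R : idomainType) (f : {rmorphism R -> R}).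
Hypothesis injf : injective f.

Local Notation "x %:F" := (@tofrac R x).

Lemma frac_repr (x : {fraction R}) : x = (repr x).1%:F / (repr x).2%:F.
Proof.
rewrite -[LHS]reprK; set r := repr x; have nz := denom_ratioP r.
unlock tofrac.
rewrite -[X in _ * X]pi_inv -[RHS]pi_mul.
by rewrite /mulf /invf !numden_Ratio ?oner_neq0 // mul1r mulr1 Ratio_numden.
Qed.

Lemma fracP (x : {fraction R}) : exists a d : R, d != 0 /\ x = a%:F / d%:F.
Proof. by exists (repr x).1, (repr x).2; split; [exact: denom_ratioP | exact: frac_repr]. Qed.

(** [frac_map] acts on the representative picked by [repr]. Cross-multiplication shows that the
    choice is immaterial, and injectivity of [f] keeps the denominators nonzero. *)
Lemma frac_map_div (a d : R) : d != 0 -> frac_map f (a%:F / d%:F) = (f a)%:F / (f d)%:F.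
Proof.
move=> nzd; rewrite /frac_map; set r := repr _.
have nzr : r.2 != 0 := denom_ratioP r.
have nzF (c : R) : c != 0 -> c%:F != 0 by rewrite tofrac_eq0.
have nzf (c : R) : c != 0 -> (f c)%:F != 0 by rewrite tofrac_eq0 (raddf_eq0 _ injf).
have /eqP := frac_repr (a%:F / d%:F); rewrite -/r eqr_div ?nzF // -!tofracM tofrac_eq => /eqP e.
apply/eqP; rewrite eqr_div ?nzf // -!tofracM tofrac_eq -!rmorphM; apply/eqP; congr (f _).
by rewrite -e.
Qed.

Lemma frac_map_tofrac (a : R) : frac_map f a%:F = (f a)%:F.
Proof.
have := frac_map_div a (oner_neq0 R).
by rewrite (rmorph1 f) tofrac1 !divr1.
Qed.

Lemma frac_map_zmod : zmod_morphism (frac_map f).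
Proof.
move=> x y; have [a [d [nzd ->]]] := fracP x; have [c [e [nze ->]]] := fracP y.
have nzF (c' : R) : c' != 0 -> c'%:F != 0 by rewrite tofrac_eq0.
have nzf (c' : R) : c' != 0 -> f c' != 0 by rewrite (raddf_eq0 _ injf).
rewrite -mulNr -tofracN addf_div ?nzF // -!tofracM -tofracD !frac_map_div ?mulf_neq0 //.
rewrite rmorphD !rmorphM rmorphN !tofracD !tofracM tofracN -addf_div ?nzF ?nzf //.
by rewrite mulNr.
Qed.

Lemma frac_map_monoid : monoid_morphism (frac_map f).
Proof.
split=> [|x y]; first by rewrite -tofrac1 frac_map_tofrac rmorph1.
have [a [d [nzd ->]]] := fracP x; have [c [e [nze ->]]] := fracP y.
by rewrite mulf_div -!tofracM !frac_map_div ?mulf_neq0 // !rmorphM /= mulf_div.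
Qed.

End FracMap.

Lemma ominus_sub (K : fieldType) (b t t' : K) : 1 + b * t != 0 -> 1 + b * t' != 0 ->
  - t' / (1 + b * t') - - t / (1 + b * t) =
  (t - t') / (1 + b * t') * (1 + b * (- t / (1 + b * t))).
Proof. by move=> nz nz'; field; rewrite nz nz'. Qed.

Lemma msymXU (R : nzRingType) m (t : 'S_m) i : msym t ('X_i : {mpoly R[m]}) = 'X_(t i).
Proof. by rewrite /msym mmapX mmap1U. Qed.

(** * The parameters and their exchange in the coefficient field *)

Section Fields.
Variable N : nat.
Implicit Type c : nat.

Lemma tpar_inj c c' : (1 <= c <= N)%N -> (1 <= c' <= N)%N -> tpar N c = tpar N c' -> c = c'.
Proof.
rewrite /tpar => h h'; rewrite h h' => /eqP; rewrite tofrac_eq => /eqP.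
move/(congr1 (mcoeff U_(inord c))); rewrite !mcoeffXU eqxx.
case: eqP => [/(congr1 val) /=|_ /eqP]; last by rewrite oner_eq0.
by rewrite !inordK; lia.
Qed.

Lemma beta_tpar_neq0 c : 1 + beta N * tpar N c != 0.
Proof.
rewrite /tpar; case: ifP => _; last by rewrite mulr0 addr0 oner_neq0.
rewrite /beta -tofracM -tofrac1 -tofracD tofrac_eq0.
apply/eqP => /(congr1 (meval (fun=> 0))); rewrite mevalD meval1 mevalM !mevalXU meval0.
by rewrite mulr0 addr0 => /eqP; rewrite oner_eq0.
Qed.

Section Sigma.
Variable j : nat.
Hypotheses (j1 : (1 <= j)%N) (jN : (j < N)%N).

HB.instance Definition _ := GRing.isZmodMorphism.Build (Fld N) (Fld N) (@sigma N j)
  (frac_map_zmod (@inj_msym _ _ _)).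
HB.instance Definition _ := GRing.isMonoidMorphism.Build (Fld N) (Fld N) (@sigma N j)
  (frac_map_monoid (@inj_msym _ _ _)).

Lemma sigmaX (i : 'I_N.+1) :
  sigma j (tofrac 'X_i) = tofrac 'X_(tperm (@inord N j) (@inord N j.+1) i).
Proof.
rewrite /sigma (frac_map_tofrac (@inj_msym _ _ _)); congr tofrac.
exact: msymXU.
Qed.

Lemma sigma_beta : sigma j (beta N) = beta N.
Proof.
rewrite /beta sigmaX tpermD // -(inj_eq val_inj) /= inordK //; lia.
Qed.

(** Valid for every [c], as G requires: [swapn j] preserves the range from 1 to [N], outside which
    [tpar] is 0. *)
Lemma sigma_tpar c : sigma j (tpar N c) = tpar N (swapn j c).
Proof.
have hc : (1 <= swapn j c <= N)%N = (1 <= c <= N)%N.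
  by rewrite /swapn; do !case: eqP => //; lia.
rewrite /tpar hc; case: ifP => [h|_]; last exact: rmorph0.
rewrite sigmaX; congr (tofrac 'X_ _).
have inE c' : (1 <= c' <= N)%N -> (@inord N c == inord c') = (c == c').
  by move=> h'; rewrite -(inj_eq val_inj) /= !inordK; lia.
rewrite /swapn; case: tpermP => [/eqP|/eqP|/eqP h1 /eqP h2].
- by rewrite inE; [move=> ->|lia].
- by rewrite inE; [move/eqP=> ->; rewrite eqxx; case: eqP => //; lia|lia].
- by move: h1 h2; rewrite !inE; [move=> /negbTE-> /negbTE->|lia|lia].
Qed.

End Sigma.
End Fields.

(** * Bethe roots *)

Section EqUpto.
Variable R : comNzRingType.
Implicit Types p q : {poly R}.

Definition eq_upto m p q := forall i, (i < m)%N -> p`_i = q`_i.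

Lemma eq_uptoD m p q p' q' : eq_upto m p p' -> eq_upto m q q' -> eq_upto m (p + q) (p' + q').
Proof. by move=> h h' i lt; rewrite !coefD h ?h'. Qed.

Lemma eq_uptoM m p q p' q' : eq_upto m p p' -> eq_upto m q q' -> eq_upto m (p * q) (p' * q').
Proof.
move=> h h' i lt; rewrite !coefM; apply: eq_bigr => l _; rewrite h ?h' //.
  exact: leq_ltn_trans (leq_subr _ _) lt.
by apply: leq_ltn_trans lt; rewrite -ltnS.
Qed.

Lemma eq_upto_prod m (I : finType) (P : pred I) (F G : I -> {poly R}) :
  (forall i, eq_upto m (F i) (G i)) -> eq_upto m (\prod_(i | P i) F i) (\prod_(i | P i) G i).
Proof. by move=> h; elim/big_ind2: _ => // *; apply: eq_uptoM. Qed.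

Lemma eq_uptoX m e p q : eq_upto m p q -> eq_upto m (p ^+ e) (q ^+ e).
Proof. by move=> h; elim: e => // e IH; rewrite !exprS; apply: eq_uptoM. Qed.

(** In the coefficient of degree [i + 1] the middle terms agree, and the top coefficient of the
    first factor meets the vanishing constant term of the second. *)
Lemma coefM_top i p q p' q' : eq_upto i.+1 p p' -> eq_upto i.+1 q q' -> q`_0 = 0 ->
  (p * q)`_i.+1 - (p' * q')`_i.+1 = p`_0 * (q`_i.+1 - q'`_i.+1).
Proof.
move=> h h' q0; have q'0 : q'`_0 = 0 by rewrite -h'.
have ends (a b : {poly R}) : (a * b)`_i.+1 =
    a`_0 * b`_i.+1 + (\sum_(l < i) a`_l.+1 * b`_(i - l) + a`_i.+1 * b`_0).
  by rewrite coefM big_ord_recl subn0 big_ord_recr /= subnn.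
rewrite !ends q0 q'0 !mulr0 !addr0 (h 0%N) // mulrBr opprD addrACA -sumrB.
rewrite big1 ?addr0 // => l _; have ltl := ltn_ord l.
by rewrite h ?h' ?subrr //; lia.
Qed.

End EqUpto.

Section BetheUnique.
Variables (K : fieldType) (n N : nat) (b : K) (t : 'I_N -> K).
Hypotheses (injt : injective t) (nzt : forall c, 1 + b * t c != 0).

(** The Bethe equation of [bae_lhs] over any field, with [b] and [t] as arguments so that they can
    be mapped or permuted. *)
Definition bae (m : nat) (y : 'I_n -> nat -> K) (l : 'I_n) : {poly K} :=
  (-1) ^+ n * (\prod_(l' < n) (1 + b%:P * trunc m (y l'))) *
  (\prod_(c < N) ((trunc m (y l) - (t c)%:P) * ((1 + b * t c)^-1)%:P))
  + 'X * (1 + b%:P * trunc m (y l)) ^+ n.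

Lemma coef_trunc m (z : nat -> K) i : (trunc m z)`_i = if (i < m)%N then z i else 0.
Proof. by rewrite coef_poly. Qed.

(* Only the factor of t_(c l) vanishes at q = 0, so the coefficient of q^i in
   the l-th equation determines y l i from the lower coefficients. *)
Lemma bethe_unique (c : 'I_n -> 'I_N) (y w : 'I_n -> nat -> K) :
  (forall l, y l 0%N = t (c l)) -> (forall l, w l 0%N = t (c l)) ->
  (forall m l, take_poly m (bae m y l) = 0) -> (forall m l, take_poly m (bae m w l) = 0) ->
  forall l i, y l i = w l i.
Proof.
move=> y0 w0 ey ew l i; move: l; have [m] := ubnP i; elim: m i => // m IHm [|i] lti l.
  by rewrite y0 w0.
have eqt l' : eq_upto i.+1 (trunc i.+2 (y l')) (trunc i.+2 (w l')).
  by move=> e lte; rewrite !coef_trunc; case: ifP => // _; apply: IHm; lia.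
have eqY l' : eq_upto i.+1 (1 + b%:P * trunc i.+2 (y l')) (1 + b%:P * trunc i.+2 (w l')).
  by apply: eq_uptoD => //; apply: eq_uptoM.
pose U (z : 'I_n -> nat -> K) := (-1) ^+ n * (\prod_(l' < n) (1 + b%:P * trunc i.+2 (z l'))) *
  ((\prod_(d < N | d != c l) ((trunc i.+2 (z l) - (t d)%:P) * ((1 + b * t d)^-1)%:P)) *
    ((1 + b * t (c l))^-1)%:P).
have baeE z : bae i.+2 z l = U z * (trunc i.+2 (z l) - (t (c l))%:P)
    + 'X * (1 + b%:P * trunc i.+2 (z l)) ^+ n.
  rewrite /bae /U (bigD1 (c l)) //=; congr (_ + _); ring.
have co z : take_poly i.+2 (bae i.+2 z l) = 0 -> (bae i.+2 z l)`_i.+1 = 0.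
  by move/(congr1 (fun p : {poly K} => p`_i.+1)); rewrite coef_take_poly ltnSn coef0.
have : (bae i.+2 y l)`_i.+1 = (bae i.+2 w l)`_i.+1 by rewrite !co.
rewrite !baeE !coefD !coefXM /=.
(* The second term carries a factor $q$, so it involves only lower coefficients, which agree by
   induction, and cancels. *)
rewrite (eq_uptoX n (eqY l)) // => /addIr /eqP; rewrite -subr_eq0 coefM_top; last first.
- by rewrite coefB coefC coef_trunc /= y0 subrr.
- by apply: eq_uptoD.
- apply: eq_uptoM; first by apply: eq_uptoM => //; apply: eq_upto_prod.
  by apply: eq_uptoM => //; apply: eq_upto_prod => d; apply: eq_uptoM => //; apply: eq_uptoD.
rewrite !coefB !coefC !coef_trunc ltnSn /= !subr0 mulf_eq0 subr_eq0 => /orP[|/eqP//].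
(* It remains to exclude that [U y] vanishes at $q=0$: there it is a product of units and of
   differences of distinct parameters. *)
have h0 (z : nat -> K) : (trunc i.+2 z).[0] = z 0%N by rewrite horner_coef0 coef_trunc.
rewrite -horner_coef0 /U !(hornerM, horner_exp, horner_prod, hornerN, hornerC).
rewrite !mulf_eq0 invr_eq0 (negbTE (nzt _)) orbF signr_eq0 /=.
case/orP => /prodf_eq0[d].
  by rewrite !hornerE h0 y0 (negbTE (nzt _)).
move=> ne; rewrite !hornerE h0 y0 mulf_eq0 invr_eq0 (negbTE (nzt _)) orbF subr_eq0.
by rewrite (inj_eq injt) eq_sym (negbTE ne).
Qed.

End BetheUnique.

Section MapBae.
Variables (K : fieldType) (f : {rmorphism K -> K}) (n N : nat) (b : K) (t : 'I_N -> K).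

Lemma map_trunc m (z : nat -> K) : map_poly f (trunc m z) = trunc m (f \o z).
Proof.
apply/polyP => i; rewrite coef_map /= !coef_trunc; case: ifP => // _.
exact: rmorph0.
Qed.

Lemma map_bae m (y : 'I_n -> nat -> K) l :
  map_poly f (bae b t m y l) = bae (f b) (f \o t) m (fun l' => f \o y l') l.
Proof.
have lin z : map_poly f (1 + b%:P * trunc m z) = 1 + (f b)%:P * trunc m (f \o z).
  by rewrite rmorphD rmorph1 rmorphM /= map_polyC map_trunc.
rewrite /bae rmorphD !rmorphM !rmorphXn !rmorph_prod /= rmorphN rmorph1 map_polyX lin.
congr (_ * _ * _ + _); apply: eq_bigr => c _; first exact: lin.
rewrite rmorphM rmorphB /= !map_polyC map_trunc /=.
by rewrite fmorphV rmorphD rmorph1 rmorphM.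
Qed.

Lemma bae_perm (p : 'S_N) m (y : 'I_n -> nat -> K) l : bae b (t \o p) m y l = bae b t m y l.
Proof.
rewrite /bae; congr (_ * _ + _).
by rewrite [RHS](reindex_inj (@perm_inj _ p)).
Qed.

Lemma bae_reindex (p : 'S_n) m (y : 'I_n -> nat -> K) l :
  bae b t m (fun l' => y (p l')) l = bae b t m y (p l).
Proof.
rewrite /bae; congr (_ * _ * _ + _).
by rewrite [RHS](reindex_inj (@perm_inj _ p)).
Qed.

Lemma eq_bae (b' : K) (t' : 'I_N -> K) m (y : 'I_n -> nat -> K) l :
  b = b' -> t =1 t' -> bae b t m y l = bae b' t' m y l.
Proof.
by move=> <- e; rewrite /bae; congr (_ * _ + _); apply: eq_bigr => c _; rewrite e.
Qed.

End MapBae.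

Lemma rmorph_Gfact (R R' : comNzRingType) (f : {rmorphism R -> R'}) (b : R) n k lam
    (x : 'I_n -> R) (s : nat -> R) :
  f (Gfact b k lam x s) = Gfact (f b) k lam (f \o x) (f \o s).
Proof.
rewrite /Gfact rmorph_sum; apply: eq_bigr => T _.
rewrite rmorphM rmorphXn rmorph_prod; congr (_ * _); apply: eq_bigr => bx _.
rewrite rmorph_prod; apply: eq_bigr => r _.
by rewrite /oplus !rmorphD !rmorphM.
Qed.

Lemma eq_Gfact (R : comNzRingType) (b : R) n k lam (x x' : 'I_n -> R) (s s' : nat -> R) :
  x =1 x' -> s =1 s' -> Gfact b k lam x s = Gfact b k lam x' s'.
Proof.
move=> ex es; rewrite /Gfact; apply: eq_bigr => T _; congr (_ * _).
by apply: eq_bigr => bx _; apply: eq_bigr => r _; rewrite ex es.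
Qed.

(** The truncations lie in the domain [{poly K}], so [Gfact_swap] applies to them and the identity
    is exact. Length [m + 1] retains the constant terms, from which invertibility conditions and
    distinctness of the letters are read. *)
Lemma Gfact_trunc_swap (K : fieldType) (f : {rmorphism K -> K}) n k (b : K) (t : nat -> K)
    j lam (y y' : 'I_n -> nat -> K) (p : 'S_n) m :
  (1 <= j)%N -> (j <= n + k - 1)%N -> in_box n k lam ->
  f b = b -> (forall c, f (t c) = t (swapn j c)) -> (forall c, 1 + b * t c != 0) ->
  (forall l, f \o y' (p l) =1 y l) -> (forall l, 1 + b * y l 0%N != 0) ->
  injective (fun l => y l 0%N) ->
  let G la z := Gfact b%:P k la (fun l => trunc m.+1 (z l)) (fun c => (- t c / (1 + b * t c))%:P) in
  map_poly f (G lam y') - G lam y -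
  (if (j \notin Iseq n lam) && (j.+1 \in Iseq n lam)
   then ((t j - t j.+1) / (1 + b * t j.+1))%:P * (b%:P * G lam y + G (sj_part n j lam) y)
   else 0) = 0.
Proof.
move=> j1 jN box fb ft nzt hp nzy injy G.
pose x (l : 'I_n) := trunc m.+1 (y l).
pose s (c : nat) := (- t c / (1 + b * t c))%:P.
pose s' (c : nat) := s (swapn j c).
have x0 l : (x l)`_0 = y l 0%N by rewrite coef_trunc.
have nz l : 1 + b%:P * x l != 0.
  apply/eqP => /(congr1 (fun q : {poly K} => q`_0)); rewrite coefD coefCM x0 coef1 coef0.
  exact/eqP.
have injx : injective x.
  by move=> l l' /(congr1 (fun q : {poly K} => q`_0)); rewrite !x0 => /injy.
have -> : map_poly f (G lam y') = Gfact b%:P k lam x s'.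
  pose z (l : 'I_n) := trunc m.+1 (f \o y' l).
  have zx : z =1 x \o (p^-1)%g.
    by move=> l; apply/polyP => i; rewrite !coef_trunc -hp /= permKV.
  (* The mapped root agrees with [y] only up to the reordering [p], which the symmetry of G
     absorbs. *)
  rewrite -(Gfact_perm _ (p^-1)%g box nz injx) rmorph_Gfact /= map_polyC /= fb.
  apply: eq_Gfact => [l|c]; first by rewrite -zx /= map_trunc.
  rewrite /= map_polyC /=; congr (_%:P).
  by rewrite rmorphM rmorphN fmorphV rmorphD rmorph1 rmorphM /= fb ft.
have Dk : s j.+1 - s j = ((t j - t j.+1) / (1 + b * t j.+1))%:P * (1 + b%:P * s j).
  by rewrite /s -polyCB ominus_sub // -!polyCM -polyC1 -polyCD -polyCM.
have := Gfact_swap j1 jN nz injx (fun c => erefl (s' c)) Dk box.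
by move=> ->; rewrite subrr.
Qed.

Section Bethe.
Variables (n k j : nat).
Let N := (n + k)%N.
Hypotheses (j1 : (1 <= j)%N) (jN : (j <= n + k - 1)%N).

Let ltjN : (j < N)%N. Proof. by rewrite /N; lia. Qed.

Lemma is_bethe_unique mu (y w : 'I_n -> nat -> Fld N) : in_box n k mu ->
  is_bethe mu y -> is_bethe mu w -> forall l, y l =1 w l.
Proof.
move=> box [y0 ey] [w0 ew].
have hc (l : 'I_n) : ((nth 0%N (Iseq n mu) l).-1 < N)%N.
  have /(Iseq_range box) : nth 0%N (Iseq n mu) l \in Iseq n mu by rewrite mem_nth ?size_Iseq.
  by rewrite /N; lia.
have hc1 (l : 'I_n) : (nth 0%N (Iseq n mu) l).-1.+1 = nth 0%N (Iseq n mu) l.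
  have /(Iseq_range box) : nth 0%N (Iseq n mu) l \in Iseq n mu by rewrite mem_nth ?size_Iseq.
  by lia.
apply: (@bethe_unique _ n N (beta N) (fun c : 'I_N => tpar N c.+1) _ _
  (fun l => Ordinal (hc l)) y w _ _ ey ew) => /=.
- move=> c c' /tpar_inj e; apply/val_inj/eqP.
  by rewrite -eqSS; apply/eqP/e => /=.
- by move=> c; apply: beta_tpar_neq0.
- by move=> l; rewrite hc1 y0.
- by move=> l; rewrite hc1 w0.
Qed.

(** [sigma j] fixes [beta] and transposes two of the parameters, in which the Bethe equations are
    symmetric. *)
Lemma bae_sigma m (y : 'I_n -> nat -> Fld N) l :
  map_poly (@sigma N j) (bae_lhs m y l) = bae_lhs m (fun l' => sigma j \o y l') l.
Proof.
have lt1 : (j.-1 < N)%N by lia.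
transitivity (bae (beta N) ((fun c : 'I_N => tpar N c.+1) \o tperm (Ordinal lt1) (Ordinal ltjN))
  m (fun l' => sigma j \o y l') l); last exact: bae_perm.
transitivity (bae (sigma j (beta N)) (fun c : 'I_N => sigma j (tpar N c.+1))
  m (fun l' => sigma j \o y l') l); first exact: map_bae.
apply: eq_bae => [|c]; first exact: sigma_beta.
rewrite /comp (sigma_tpar j1 ltjN).
have -> : swapn j c.+1 = (tperm (Ordinal lt1) (Ordinal ltjN) c).+1; last by [].
rewrite /swapn; case: tpermP => [->|->|/eqP h1 /eqP h2] /=; last rewrite -!(inj_eq val_inj) /= in h1 h2.
- by do !case: eqP => //; lia.
- by do !case: eqP => //; lia.
- by do !case: eqP => //; lia.
Qed.

(** Index lists are increasing, so the image of a list under [swapn j] needs re-sorting when it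
    contains both [j] and [j + 1]; [p] records this. *)
Lemma sj_perm mu : in_box n k mu -> exists p : 'S_n, forall l : 'I_n,
  nth 0%N (Iseq n (sj_part n j mu)) (p l) = swapn j (nth 0%N (Iseq n mu) l).
Proof.
move=> box.
have In (l : 'I_n) : swapn j (nth 0%N (Iseq n mu) l) \in Iseq n (sj_part n j mu).
  by rewrite (mem_Iseq_sj_part j1 jN box) mem_nth ?size_Iseq.
have lt (l : 'I_n) : (index (swapn j (nth 0%N (Iseq n mu) l)) (Iseq n (sj_part n j mu)) < n)%N.
  by rewrite -[ltnRHS](size_Iseq n (sj_part n j mu)) index_mem.
have inj : injective (fun l => Ordinal (lt l)).
  move=> l l' /(congr1 val) /= /(congr1 (nth 0%N (Iseq n (sj_part n j mu)))).
  rewrite !nth_index // => /(can_inj (@swapnK j)) /eqP.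
  rewrite nth_uniq ?size_Iseq // => [/eqP/val_inj //|].
  exact: sorted_uniq ltn_trans ltnn _ (Iseq_sorted box).
by exists (perm inj) => l; rewrite permE /= nth_index.
Qed.

Lemma sigma_bethe mu (y y' : 'I_n -> nat -> Fld N) : in_box n k mu ->
  is_bethe mu y -> is_bethe (sj_part n j mu) y' ->
  exists p : 'S_n, forall l, sigma j \o y' (p l) =1 y l.
Proof.
move=> box by_ [y0 ey]; have [p hp] := sj_perm box; exists p.
apply: (is_bethe_unique box _ by_); split=> [l|m l].
  by rewrite /= y0 hp (sigma_tpar j1 ltjN) swapnK.
have -> : bae_lhs m (fun l => sigma j \o y' (p l)) l =
    map_poly (@sigma N j) (bae_lhs m y' (p l)).
  rewrite bae_sigma.
  exact: (bae_reindex (beta N) (fun c : 'I_N => tpar N c.+1) p m (fun l' => sigma j \o y' l')).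
apply/polyP => i; have := congr1 (fun q : {poly Fld N} => q`_i) (ey m (p l)).
rewrite !coef_take_poly !coef0; case: ifP => // _ e.
by rewrite coef_map /= e rmorph0.
Qed.

End Bethe.

Theorem mainTheorem2 (n k : nat) (lam mu : seq nat) (j : nat)
    (y y' : 'I_n -> nat -> Fld (n + k)) :
  in_box n k lam -> in_box n k mu ->
  (1 <= j)%N -> (j <= n + k - 1)%N ->
  @is_bethe n (n + k) mu y ->
  @is_bethe n (n + k) (sj_part n j mu) y' ->
  forall m : nat,
    take_poly m
      (map_poly (@sigma (n + k) j) (@Gy n k lam m y') - @Gy n k lam m y
       - (if (j \notin Iseq n lam) && (j.+1 \in Iseq n lam)
          then (@fominus (n + k) (tpar (n + k) j) (tpar (n + k) j.+1))%:P *
               ((beta (n + k))%:P * @Gy n k lam m y + @Gy n k (sj_part n j lam) m y)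
          else 0)) = 0.
Proof.
(* Modulo $q^0$ there is nothing to prove. For [m + 1] the polynomial is shown to be zero even
   before truncation. *)
move=> boxl boxm j1 jN bey bey' [|m]; first exact: take_poly0l.
have ltjN : (j < n + k)%N by lia.
have [p hp] := sigma_bethe j1 jN boxm bey bey'.
have [y0 _] := bey.
apply: etrans (take_poly0r _ m.+1); congr (take_poly m.+1 _).
apply: (@Gfact_trunc_swap (Fld (n + k)) (@sigma (n + k) j) n k (beta (n + k)) (tpar (n + k))
  j lam y y' p m j1 jN boxl).
- exact: sigma_beta.
- by move=> c; apply: sigma_tpar.
- exact: beta_tpar_neq0.
- exact: hp.
- by move=> l; rewrite y0; apply: beta_tpar_neq0.
- move=> l l'; rewrite !y0 => e.
  have rng (i : 'I_n) : (1 <= nth 0%N (Iseq n mu) i <= n + k)%N.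
    by apply: (Iseq_range boxm); rewrite mem_nth ?size_Iseq.
  have /eqP := tpar_inj (rng l) (rng l') e.
  rewrite nth_uniq ?size_Iseq // => [/eqP/val_inj //|].
  exact: sorted_uniq ltn_trans ltnn _ (Iseq_sorted boxm).
Qed.
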